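(* Up to isomorphism, there are only countably many Euclidean cut and project schemes $\mathcal{S}=(\mathbb{E},\mathbb{E}_\vee,\mathbb{E}_<,\Gamma)$ for which there is some window $W$ making the elements of $\Omega(\mathcal{S},W)$ all $L$-sub for some expansive linear map $L\colon\mathbb{E}_\vee\to\mathbb{E}_\vee$. For each such scheme $\mathcal{S}$, there are only countably many such windows $W$, up to translation.
   Context: **Patterns.** A Delone multiset in a finite-dimensional real normed space $E$ is a tuple $\Lambda=(\Lambda_1,\dots,\Lambda_\ell)$ of subsets of $E$ whose union is uniformly discrete and relatively dense. Translates and linear images $L\Lambda$ are taken componentwise. A patch of $\Lambda$ is a tuple $(\Lambda_i\cap U)_i$ with $U$ bounded. With $B(x,r)$ the closed ball, $\Lambda[x,r]:=((\Lambda_i\cap B(x,r))-x)_i$. $\mathcal{Q}$ is locally derivable (LD) from $\mathcal{P}$ if there is $c\ge0$ such that for all $x,y\in E$, $\mathcal{P}[x,c]=\mathcal{P}[y,c]$ implies $\mathcal{Q}[x,0]=\mathcal{Q}[y,0]$. $\mathcal{P}$ is locally indistinguishable (LI) from $\mathcal{Q}$ if every patch of $\mathcal{P}$ occurs, up to translation, in $\mathcal{Q}$. The hull $\Omega_{\mathcal{P}}$ is the set of all patterns LI from $\mathcal{P}$. For a linear automorphism $L$ of $E$, $\mathcal{P}$ is $L$-sub if there is $\mathcal{P}'$, LI from $\mathcal{P}$, such that $\mathcal{P}$ is LD from $L\mathcal{P}'$. A linear map is expansive if all its eigenvalues have modulus $>1$. **Cut and project.** A Euclidean cut and project scheme $\mathcal{S}=(\mathbb{E},\mathbb{E}_\vee,\mathbb{E}_<,\Gamma)$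 consists of a $k$-dimensional real vector space $\mathbb{E}$, complementary subspaces $\mathbb{E}_\vee$ of dimension $d>0$ and $\mathbb{E}_<$ of dimension $k-d>0$, and a full rank lattice $\Gamma\subset\mathbb{E}$. Write $x_\vee,x_<$ for the projections of $x$ to $\mathbb{E}_\vee,\mathbb{E}_<$ along $\mathbb{E}=\mathbb{E}_\vee\oplus\mathbb{E}_<$. It is required that $\gamma\mapsto\gamma_\vee$, $\gamma\mapsto\gamma_<$ are injective on $\Gamma$ and $\Gamma_<$ is dense in $\mathbb{E}_<$. A window is a finite tuple $W=(W_i)_{i=1}^\ell$ of compact, topologically regular (equal to the closure of their interior) subsets of $\mathbb{E}_<$, not all empty. It is non-singular if $\Gamma_<\cap\partial W_i=\emptyset$ for all $i$; then $\Lambda(\mathcal{S},W)=(\Lambda_i)_i$, $\Lambda_i=\{\gamma_\vee:\gamma\in\Gamma,\gamma_<\in W_i\}$. For arbitrary $W$, $\Omega(\mathcal{S},W):=\Omega_{\Lambda(\mathcal{S},W+s)}$ for any $s\in\mathbb{E}_<$ with $W+s$ non-singular (independent of $s$). Two schemes $(\mathbb{E},\mathbb{E}_\vee,\mathbb{E}_<,\Gamma)$ and $(\mathbb{E}',\mathbb{E}'_\vee,\mathbb{E}'_<,\Gamma')$ are isomorphic if there is a linear isomorphism $f\colon\mathbb{E}\to\mathbb{E}'$ with $f(\mathbb{E}_\vee)=\mathbb{E}'_\vee$, $f(\mathbb{E}_<)=\mathbb{E}'_<$ and $f(\Gamma)=\Gamma'$. *)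

(* Defs.v *)
From HB Require Import structures.
From mathcomp Require Import all_boot all_order all_algebra.
From mathcomp Require Import complex.
From mathcomp Require Import all_classical all_reals all_analysis.

Set Implicit Arguments.
Unset Strict Implicit.
Unset Printing Implicit Defensive.

Import Order.TTheory GRing.Theory Num.Def Num.Theory.
Import numFieldNormedType.Exports passmx.

Local Open Scope classical_set_scope.
Local Open Scope ring_scope.

(** [normed V] is the finite-dimensional real vector space [V] with the
    sup norm of its coordinates.  All norms on [V] are equivalent, and none of
    the notions below (compactness, Delone sets, local derivability, ...)
    changes when the norm is replaced by an equivalent one. *)
Definition normed (R : realType) (V : vectType R) : Type := V.

Section NormedVect.
Variables (R : realType) (V : vectType R).

HB.instance Definition _ := Vector.on (normed V).

Let coord_norm (x : normed V) : R := `|rVof (vbasis {:V}) (x : V)|.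

Let coord_normD x y : coord_norm (x + y) <= coord_norm x + coord_norm y.
Proof. by rewrite /coord_norm linearD; exact: ler_normD. Qed.

Let coord_normZ (a : R) x : coord_norm (a *: x) = `|a| * coord_norm x.
Proof. by rewrite /coord_norm linearZ normrZ. Qed.

Let coord_norm0_eq0 x : coord_norm x = 0 -> x = 0.
Proof.
move=> /normr0_eq0 x0; apply: (can_inj (rVofK (vbasisP {:V}))).
by rewrite x0 linear0.
Qed.

HB.instance Definition _ :=
  Lmodule_isNormed.Build R (normed V) coord_normD coord_normZ coord_norm0_eq0.

End NormedVect.

Definition translate (V : zmodType) (t : V) (A : set V) : set V :=
  [set x + t | x in A].

Section Patterns.
Variables (R : realType) (E : normedModType R).

Definition pattern (l : nat) := 'I_l -> set E.

Definition uniformly_discrete (A : set E) :=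
  exists2 r : R, 0 < r & forall x y, A x -> A y -> x <> y -> r <= `|x - y|.

Definition relatively_dense (A : set E) :=
  exists r : R, forall x, exists2 y, A y & `|x - y| <= r.

Definition delone l (P : pattern l) :=
  uniformly_discrete (\bigcup_i P i) /\ relatively_dense (\bigcup_i P i).

(** [closed_ball_], unlike [closed_ball], is [{x}] for radius [0]. *)
Definition centred_patch l (P : pattern l) (x : E) (r : R) : pattern l :=
  fun i => translate (- x) (P i `&` closed_ball_ normr x r).

Definition locally_derivable l m (Q : pattern l) (P : pattern m) :=
  exists2 c : R, 0 <= c & forall x y : E,
    centred_patch P x c = centred_patch P y c ->
    centred_patch Q x 0 = centred_patch Q y 0.

(** An occurrence in [Q] of the patch of [P] on [U] is the whole patch of [Q]
    on a translate of [U]; it is not enough that [Q] contains the translated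
    points of the patch. *)
Definition locally_indistinguishable l (P Q : pattern l) :=
  forall U : set E, bounded_set U ->
  exists t : E, forall i,
    translate t (P i `&` U) = Q i `&` translate t U.

Definition hull l (P : pattern l) : set (pattern l) :=
  [set Q | delone Q /\ locally_indistinguishable Q P].

(** Only used for expansive [L], which are automorphisms (0 is no eigenvalue). *)
Definition L_sub l (L : {linear E -> E}) (P : pattern l) :=
  exists2 P' : pattern l, hull P P' &
    locally_derivable P (fun i => L @` P' i).

End Patterns.

(** Complex eigenvalues: those of the matrix of [L] in a basis of [V], over [R[i]]. *)
Definition expansive (R : realType) (V : vectType R) (L : 'End(V)) :=
  forall a : complex R,
    eigenvalue
      (map_mx (real_complex R) (mxof (vbasis {:V}) (vbasis {:V}) L)) a -> 1 < `|a|.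

Definition full_rank_lattice (R : realType) (V : vectType R) (G : set V) :=
  exists2 b : (\dim {:V}).-tuple V, basis_of {:V} b &
    G = [set \sum_(i < \dim {:V}) b`_i *~ z i | z in [set: 'I_(\dim {:V}) -> int]].

(** Projection onto [U] along [V], for complementary [U] and [V]. *)
Definition proj_along (R : realType) (E : vectType R) (U V : {vspace E})
    (x : E) : normed (subvs_of U) := vsproj U (daddv_pi U V x).

Record scheme (R : realType) := Scheme {
  total : vectType R;
  physical : {vspace total};
  internal : {vspace total};
  lattice : set total;
  physical_dim_gt0 : (0 < \dim physical)%N;
  internal_dim_gt0 : (0 < \dim internal)%N;
  physical_internal_cap : (physical :&: internal = 0)%VS;
  physical_internal_sum : (physical + internal = fullv)%VS;
  lattice_full_rank : full_rank_lattice lattice;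
  physical_proj_inj : set_inj lattice (proj_along physical internal);
  internal_proj_inj : set_inj lattice (proj_along internal physical);
  internal_proj_dense : dense (proj_along internal physical @` lattice)
}.

Arguments lattice {R} s _.

Definition scheme_iso (R : realType) (S S' : scheme R) :=
  exists f : 'Hom(total S, total S'),
    [/\ bijective f,
        (f @: physical S = physical S')%VS,
        (f @: internal S = internal S')%VS &
        f @` lattice S = lattice S'].

Notation physical_space S := (normed (subvs_of (physical S))).
Notation internal_space S := (normed (subvs_of (internal S))).

Section CutAndProject.
Variables (R : realType) (S : scheme R).

Definition physical_proj : total S -> physical_space S :=
  proj_along (physical S) (internal S).
Definition internal_proj : total S -> internal_space S :=
  proj_along (internal S) (physical S).

Definition is_window l (W : 'I_l -> set (internal_space S)) :=
  [/\ forall i, compact (W i),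
      forall i, closure (interior (W i)) = W i &
      exists i, W i !=set0].

Definition nonsingular l (W : 'I_l -> set (internal_space S)) :=
  forall i, (internal_proj @` lattice S) `&` (closure (W i) `\` interior (W i))
            = set0.

Definition cut_and_project l (W : 'I_l -> set (internal_space S)) :
    pattern (physical_space S) l :=
  fun i => [set physical_proj g
           | g in [set g | lattice S g /\ W i (internal_proj g)]].

Definition translate_window l (s : internal_space S)
    (W : 'I_l -> set (internal_space S)) : 'I_l -> set (internal_space S) :=
  fun i => translate s (W i).

(** The union over all [s] for which [W + s] is non-singular; such [s] exist
    and all give the same hull. *)
Definition window_hull l (W : 'I_l -> set (internal_space S)) :
    set (pattern (physical_space S) l) :=
  [set P | exists2 s, nonsingular (translate_window s W) &
           hull (cut_and_project (translate_window s W)) P].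

(** One expansive map [L] serves all the elements of the hull. *)
Definition expansive_sub l (W : 'I_l -> set (internal_space S)) :=
  exists2 L : 'End(physical_space S), expansive L &
    forall P, window_hull W P -> L_sub (L : {linear physical_space S -> physical_space S}) P.

Definition sub_windows : set {l : nat & 'I_l -> set (internal_space S)} :=
  [set W | is_window (projT2 W) /\ expansive_sub (projT2 W)].

Definition translation_equiv (W W' : {l : nat & 'I_l -> set (internal_space S)}) :=
  exists s, W' = existT _ (projT1 W) (translate_window s (projT2 W)).

End CutAndProject.

Arguments sub_windows {R} S _.

(** [A] has countably many classes for the equivalence relation [e]: there is
    an injection of [A] modulo [e] into [nat]. *)
Definition countable_up_to (T : Type) (e : T -> T -> Prop) (A : T -> Prop) :=
  exists code : T -> nat,
    forall x y, A x -> A y -> code x = code y <-> e x y.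

(* Main.v *)
Require Import Defs.
From HB Require Import structures.
From mathcomp Require Import all_boot all_order all_algebra.
From mathcomp Require Import complex.
From mathcomp Require Import all_classical all_reals all_analysis.
From mathcomp Require Import zify ring lra.

Set Implicit Arguments.
Unset Strict Implicit.
Unset Printing Implicit Defensive.

Import Order.TTheory GRing.Theory Num.Def Num.Theory.
Import numFieldNormedType.Exports passmx.

Local Open Scope classical_set_scope.
Local Open Scope ring_scope.

(** Write [p], [q] for the projections of the lattice [Z^k] to the physical and
    internal spaces.  If [P] is derived from [L P'] with [P'] locally
    indistinguishable from [P], iterating gives, for each [n], large regions of
    [P] which are [n]-fold substitution images of patches of [P] of a fixed size
    (bounded because [L^-1] is eventually contracting).

    Schemes: lattice vectors [g] with [q g] small are returns of the fixed-size
    patch, so [L^n (p g)] are returns of patches whose size tends to infinity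
    with [n].  Hence [L] lifts to an integer matrix [M], and since long return
    vectors of large patches are internally short, [q (M^n g)] tends to [0]: [M]
    is expanding on the physical space and contracting on the internal one.
    These two spaces are then determined by the integer matrix [M].

    Windows: [L] (through [M]), the local rule and the list of patches of the
    fixed size are countable data.  Two windows with the same data give patterns
    with arbitrarily large common patches, and by density of the internal
    projection of the lattice and compactness they are translates of each
    other. *)

(** * Finite-dimensional normed spaces *)

(** Nothing is known about [P'] beyond local indistinguishability, so the derivation cannot be
    iterated globally. After each step a patch of [P'] is exchanged for an equal patch of [P]
    elsewhere; a hierarchy therefore exists only locally, for a prescribed depth and radius. A rule
    of radius [c] costs a margin at every level, but pulled back by powers of [L^-1] the margins
    form a geometric series, so one seed radius serves all depths. Non-singularity makes patches
    stable under small internal displacements. The converse estimate, and with it the contraction on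
    the internal space, is not spectral: it holds because a nonempty bounded window has no nonzero
    period. The real constants of an expansion would make the codes uncountable, so they stay
    outside. The code of a window determines [L], and then the constants of one window serve in
    comparing it with another. *)

Lemma mx_norm_coord (R : realType) n (v : 'rV[R]_n) j : `|v ord0 j| <= `|v|.
Proof.
rewrite [X in _ <= X]/normr /= mx_normrE; apply/bigmax_geP; right.
by exists (ord0, j).
Qed.

Section NormedTheory.
Variables (R : realType) (U : vectType R).
Let e := vbasis {:U}.

Lemma normedE (x : normed U) : `|x| = `|rVof e (x : U)|.
Proof. by []. Qed.

Lemma norm_vecof (w : 'rV[R]_(\dim {:U})) : `|vecof e w : normed U| = `|w|.
Proof. by rewrite normedE vecofK ?vbasisP.  Qed.

Lemma coord_norm_le (x : normed U) i : `|coord e i (x : U)| <= `|x|.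
Proof. by rewrite normedE coord_rVof; exact: mx_norm_coord. Qed.

Lemma linear_bounded (X : normedModType R) (f : U -> X) : linear f ->
  exists2 C : R, 0 < C & forall x : normed U, `|f x| <= C * `|x|.
Proof.
move=> lf; pose g : {linear U -> X} := HB.pack f
  (GRing.isLinear.Build _ _ _ _ f lf).
exists (1 + \sum_(i < \dim {:U}) `|f e`_i|).
  by rewrite ltr_pwDl// sumr_ge0.
move=> x; rewrite {1}(coord_vbasis (memvf (x : U))).
rewrite -[f _]/(g _) linear_sum/=.
apply: le_trans (ler_norm_sum _ _ _) _.
rewrite mulrDl mul1r mulr_suml; apply: ler_wpDl => //.
apply: ler_sum => i _; rewrite -[f _]/(g _) linearZ/= normrZ mulrC.
exact: ler_wpM2l (coord_norm_le _ _).
Qed.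

Lemma vecof_continuous :
  continuous (vecof e : 'rV[R]_(\dim {:U}) -> normed U).
Proof.
move=> w; apply/(@cvgrPdist_lt _ _ _ _ (nbhs_filter w)) => eps eps0.
have := nbhsx_ballx w _ eps0; rewrite -ball_normE; apply: filterS => w' /=.
by rewrite -(norm_vecof (w - w')) linearB.
Qed.

Lemma closed_ball_compact (r : R) : compact [set x : normed U | `|x| <= r].
Proof.
have -> : [set x : normed U | `|x| <= r] =
    (vecof e : _ -> normed U) @` [set w | `|w| <= r].
  apply/seteqP; split => x /=.
    by move=> xr; exists (rVof e (x : U)) => //; rewrite rVofK// vbasisP.
  by case=> w wr <-; rewrite norm_vecof.
apply: continuous_compact.
  exact: continuous_subspaceT vecof_continuous.
apply: bounded_closed_compact.
  exists r; split; first exact: num_real.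
  by move=> s rs w /= wr; apply: le_trans wr (ltW rs).
rewrite (_ : [set w | _] = closed_ball_ normr 0 r); last first.
  by apply/seteqP; split => w /=; rewrite /closed_ball_ /= sub0r normrN.
exact: closed_closed_ball_.
Qed.

(** A Cauchy filter eventually lies in a ball, whose closure is compact. Completeness is what the
    Baire argument for non-singular translates requires. *)
Lemma normed_cauchy_cvg (F : set_system (normed U)) :
  ProperFilter F -> cauchy F -> cvg F.
Proof.
move=> FF Fc.
have [x Fx] : exists x : normed U, F (ball x 1).
  by have /cauchyP := Fc; apply.
apply: (compact_cauchy_cvg FF Fc _ (@closed_ball_compact (`|x| + 1))).
apply: filterS Fx => y; rewrite -ball_normE /= => xy.
rewrite -[y](subKr x); apply: le_trans (ler_normB _ _) _.
by rewrite lerD2l ltW.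
Qed.

HB.instance Definition _ :=
  Uniform_isComplete.Build (normed U) normed_cauchy_cvg.

End NormedTheory.

Section NormFacts.
Variables (R : realType) (X : normedModType R).

Lemma norm_triangle (a b c : X) : `|a - c| <= `|a - b| + `|b - c|.
Proof. by rewrite -[a - c](subrKA b) ler_normD. Qed.

Lemma closure_normP (A : set X) (x : X) :
  closure A x <-> forall eps, 0 < eps -> exists2 a, A a & `|x - a| < eps.
Proof.
split=> [Ax eps eps0|Ax B /nbhs_ballP[eps /= eps0]].
  have [a [Aa]] := Ax _ (nbhsx_ballx x _ eps0).
  by rewrite -ball_normE; exists a.
rewrite -ball_normE => epsB.
by have [a Aa xa] := Ax _ eps0; exists a; split => //; exact: epsB.
Qed.

Lemma interior_normP (A : set X) (x : X) :
  interior A x <-> exists2 eps, 0 < eps & forall a, `|x - a| < eps -> A a.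
Proof.
rewrite /interior /=; split=> [/nbhs_ballP[eps /= eps0]|[eps eps0 epsA]].
  by rewrite -ball_normE => epsA; exists eps.
by apply/nbhs_ballP; exists eps => //; rewrite -ball_normE.
Qed.

Lemma compact_seq_cluster (A : set X) (w : nat -> X) : compact A ->
  (forall n, A (w n)) -> exists2 a, A a &
  forall eps N, 0 < eps -> exists2 n, (N <= n)%N & `|w n - a| < eps.
Proof.
move=> cA Aw; have FF : ProperFilter (w @ \oo) by exact: fmap_proper_filter.
have [|a [Aa cla]] := cA _ FF.
  by apply: filterS (filterT : \oo setT) => n _; exact: Aw.
exists a => // eps N eps0.
have [] := cla (w @` [set n | (N <= n)%N]) _ _ (nbhsx_ballx a _ eps0).
  by exists N => // n /= Nn; exists n.
by rewrite -ball_normE => _ [[n /= Nn <-]] /= awn; exists n => //; rewrite distrC.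
Qed.

Lemma compact_norm_bounded (A : set X) : compact A ->
  exists2 B, 0 < B & forall a, A a -> `|a| <= B.
Proof.
move=> /compact_bounded[M [_ MA]]; exists (`|M| + 1); first by rewrite ltr_wpDl.
by move=> a Aa; apply: MA => //; rewrite ltr_pwDr// ler_norm.
Qed.

Lemma nat_ub (x : R) : exists n : nat, x <= n%:R.
Proof.
exists (Num.Def.truncn `|x|).+1; apply: le_trans (ler_norm _) _.
by rewrite ltW// truncnS_gt.
Qed.

Lemma family_norm_bounded l (A : 'I_l -> set X) :
  (forall i, compact (A i)) ->
  exists2 B, 0 < B & forall i a, A i a -> `|a| <= B.
Proof.
move=> cA.
have /choice[B B0] : forall i, exists r : R,
    0 < r /\ forall a, A i a -> `|a| <= r.
  by move=> i; have [B B0 AB] := compact_norm_bounded (cA i); exists B.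
exists (1 + \sum_i B i).
  by rewrite ltr_pwDl// sumr_ge0// => i _; rewrite ltW// (B0 i).1.
move=> i a Aa; apply: le_trans ((B0 i).2 _ Aa) _.
rewrite (bigD1 i)//= addrCA lerDl addr_ge0// sumr_ge0// => j _.
by rewrite ltW// (B0 j).1.
Qed.

End NormFacts.

(** * Model sets *)

(* The lattice is Z^k with its two projections [p] and [q]. *)
Record projection_scheme (R : realType) (V H : normedModType R) (k : nat)
    (p : {additive 'rV[int]_k -> V}) (q : {additive 'rV[int]_k -> H}) : Prop :=
  ProjectionScheme {
  ps_inj : injective p;
  ps_dense : forall h eps, 0 < eps -> exists z, `|q z - h| < eps;
  ps_discrete : forall C, exists s : seq 'rV[int]_k,
    forall z, `|p z| <= C -> `|q z| <= C -> z \in s;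
  ps_cocompact : exists K, forall v h, exists z, `|p z - v| <= K /\ `|q z - h| <= K;
  ps_compact : forall r, compact [set h : H | `|h| <= r] }.

Definition regular_window (R : realType) (H : normedModType R) l
    (W : 'I_l -> set H) : Prop :=
  [/\ forall i, compact (W i),
      forall i, closure (interior (W i)) = W i &
      exists i, W i !=set0].

Lemma regular_window_closure (R : realType) (H : normedModType R) l
  (W : 'I_l -> set H) i : regular_window W -> closure (W i) = W i.
Proof.
case=> _ /(_ i) <- _; apply/esym/closure_id; exact: closed_closure.
Qed.

(** The region [D] is arbitrary because the regions produced by substitution are preimages of balls
    under powers of [L^-1], not balls; the two patterns may differ so that two windows can be
    compared. *)
Definition agree (R : realType) (V : normedModType R) l (D : set V)
    (P : pattern V l) (x : V) (P' : pattern V l) (x' : V) :=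
  forall i u, D u -> P i (x + u) <-> P' i (x' + u).

Definition nball (R : realType) (V : normedModType R) (r : R) : set V :=
  [set v | `|v| <= r].
Arguments nball {R V} r _ /.

Section Agree.
Variables (R : realType) (V : normedModType R) (l : nat).
Implicit Types (P Q : pattern V l) (x y u : V) (D : set V).

Lemma agree_sym D P x Q y : agree D P x Q y -> agree D Q y P x.
Proof. by move=> PQ i u Du; rewrite PQ. Qed.

Lemma agree_trans D Q y P x P' x' :
  agree D P x Q y -> agree D Q y P' x' -> agree D P x P' x'.
Proof. by move=> PQ QP' i u Du; rewrite PQ// QP'. Qed.

Lemma agree_subset D D' P x Q y : D' `<=` D -> agree D P x Q y -> agree D' P x Q y.
Proof. by move=> sD PQ i u /sD /PQ. Qed.

Lemma agree_le r s P x Q y : s <= r ->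
  agree (nball r) P x Q y -> agree (nball s) P x Q y.
Proof. by move=> sr; apply: agree_subset => u /= us; apply: le_trans us sr. Qed.

Lemma agree_shift r s u P x Q y : `|u| <= s ->
  agree (nball r) P x Q y -> agree (nball (r - s)) P (x + u) Q (y + u).
Proof.
move=> us PQ i v /= vr; rewrite -!addrA; apply: PQ => /=.
by apply: le_trans (ler_normD _ _) _; rewrite -(subrKC s r) lerD.
Qed.

End Agree.

Section ProjectionScheme.
Variables (R : realType) (V H : normedModType R) (k : nat).
Variables (p : {additive 'rV[int]_k -> V}) (q : {additive 'rV[int]_k -> H}).
Hypothesis pqS : projection_scheme p q.

Definition model_set l (W : 'I_l -> set H) : pattern V l :=
  fun i => [set p z | z in [set z | W i (q z)]].

Lemma model_setE l (W : 'I_l -> set H) i z : model_set W i (p z) <-> W i (q z).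
Proof.
split=> [[z' Wz' /(ps_inj pqS) <-]//|Wz]; by exists z.
Qed.

Lemma model_set_img l (W : 'I_l -> set H) i v :
  model_set W i v -> exists2 z, v = p z & W i (q z).
Proof. by case=> z Wz <-; exists z. Qed.

(** Density alone gives no control on the physical component. Compactness makes that control uniform
    over internal targets of norm at most [K], and cocompactness reduces every pair [(v, h)] to such
    a target. *)
Lemma uniform_density eps : 0 < eps -> exists2 rho, 0 < rho &
  forall v h, exists z, `|p z - v| <= rho /\ `|q z - h| < eps.
Proof.
move=> eps0; have [K KP] := ps_cocompact pqS.
have [N NP] : exists N : nat, forall h, `|h| <= K ->
    exists z, `|p z| <= N%:R /\ `|q z - h| < eps.
  apply: contrapT => /forallNP nP.
  have /choice[w wP] : forall N : nat, exists h, `|h| <= K /\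
      forall z, `|p z| <= N%:R -> eps <= `|q z - h|.
    move=> N; have /existsNP[h /not_implyP[hK /forallNP hP]] := nP N.
    exists h; split => // z pz; rewrite leNgt; apply/negP => qz.
    by apply: (hP z).
  have [a _ wa] := compact_seq_cluster (ps_compact pqS (r := K)) (fun n => (wP n).1).
  have eps2 : 0 < eps / 2 by rewrite divr_gt0.
  (* One lattice vector close to the cluster point [a] refutes a supposed counterexample of index
     beyond [|p z|]. *)
  have [z qza] := ps_dense pqS a eps2.
  have [N pzN] := nat_ub `|p z|.
  have [n Nn wna] := wa _ N eps2.
  have := (wP n).2 z (le_trans pzN _); rewrite ler_nat => /(_ Nn).
  apply/negP; rewrite -ltNge; apply: le_lt_trans (norm_triangle _ a _) _.
  by rewrite [ltRHS](splitr eps) ltrD// distrC.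
exists (`|K| + N%:R + 1); first by rewrite ltr_wpDl// addr_ge0.
move=> v h; have [z0 [pz0 qz0]] := KP v h.
have [|z1 [pz1 qz1]] := NP (h - q z0); first by rewrite distrC.
exists (z0 + z1); rewrite !raddfD/= [p z0 + p z1 - v]addrAC; split.
  apply: le_trans (ler_normD _ _) _; rewrite -addrA lerD//.
    by apply: le_trans pz0 (ler_norm _).
  by rewrite ler_wpDr.
by move: qz1; rewrite opprB addrCA addrA.
Qed.

Lemma window_interior l (W : 'I_l -> set H) : regular_window W ->
  exists i h, interior (W i) h.
Proof.
case=> _ Wreg [i [h]]; rewrite -(Wreg i) => /(_ setT filterT)[h' [h'W _]].
by exists i, h'.
Qed.

(** A ball inside the window suffices. One component [i] serves all [v], so two large agreeing
    patches always share a point of a known component, by which they can be anchored to the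
    lattice. *)
Lemma model_set_dense l (W : 'I_l -> set H) : regular_window W ->
  exists2 rho, 0 < rho &
  exists i, forall v, exists2 z, `|p z - v| <= rho & W i (q z).
Proof.
move=> /window_interior[i [h /interior_normP[eps eps0 hW]]].
have [rho rho0 rhoP] := uniform_density eps0; exists rho => //; exists i => v.
have [z [pz qz]] := rhoP v h; exists z => //.
by apply: hW; rewrite distrC.
Qed.

(** By regularity [h] is close to an interior point of [W i], which lattice vectors near [y n]
    approximate from within [W i]. Their shifts by [m n] land in [W' i] close to [h + w], and [W' i]
    is closed. *)
Lemma limit_subset l (W W' : 'I_l -> set H) (y : nat -> V)
    (m : nat -> 'rV[int]_k) (w : H) : regular_window W -> regular_window W' ->
  (forall n i g, `|p g - y n| <= n%:R -> W i (q g) -> W' i (q (g + m n))) ->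
  (forall eps N, 0 < eps -> exists2 n, (N <= n)%N & `|q (m n) - w| < eps) ->
  forall i h, W i h -> W' i (h + w).
Proof.
move=> rW rW' ym mw i h Wh; have [_ Wreg _] := rW.
rewrite -(regular_window_closure i rW'); apply/closure_normP => eps eps0.
have eps2 : 0 < eps / 2 by rewrite divr_gt0.
have eps4 : 0 < eps / 2 / 2 by rewrite divr_gt0.
move: Wh; rewrite -{1}Wreg => /closure_normP/(_ _ eps4)[a /interior_normP].
move=> [del del0 aW] ha.
have del' : 0 < Num.min del (eps / 2 / 2) by rewrite lt_min del0.
have [rho _ rhoP] := uniform_density del'.
have [N rhoN] := nat_ub rho.
have [n Nn mnw] := mw _ N eps2.
have [g [pg]] := rhoP (y n) a; rewrite lt_min => /andP[qg1 qg2].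
exists (q (g + m n)).
  apply: ym; last by apply: aW; rewrite distrC.
  by apply: le_trans pg _; apply: le_trans rhoN _; rewrite ler_nat.
rewrite raddfD/= opprD addrACA; apply: le_lt_trans (ler_normD _ _) _.
rewrite [ltRHS](splitr eps) ltrD//; last by rewrite distrC.
apply: le_lt_trans (norm_triangle _ a _) _.
by rewrite [ltRHS](splitr (eps / 2)) ltrD// distrC.
Qed.

(** The displacements [q (m n)] are differences of window points, hence bounded, and cluster at some
    [w]; [limit_subset] then applies in both directions. *)
Lemma limit_translate l (W W' : 'I_l -> set H) (y : nat -> V)
    (m : nat -> 'rV[int]_k) : regular_window W -> regular_window W' ->
  (forall n i g, `|p g - y n| <= n%:R -> W i (q g) <-> W' i (q (g + m n))) ->
  exists2 w, (forall i, W' i = translate w (W i)) &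
    forall eps N, 0 < eps -> exists2 n, (N <= n)%N & `|q (m n) - w| < eps.
Proof.
move=> rW rW' ym.
have [B B0 WB] := family_norm_bounded (let: And3 c _ _ := rW in c).
have [B' B'0 W'B] := family_norm_bounded (let: And3 c _ _ := rW' in c).
have [rho _ [i0 rhoP]] := model_set_dense rW.
have [N0 rhoN0] := nat_ub rho.
(* The offset [N0] makes each ball large enough to contain a point of component [i0]. *)
have mB n : `|q (m (n + N0)%N)| <= B + B'.
  have [z pz Wz] := rhoP (y (n + N0)%N).
  have W'z : W' i0 (q (z + m (n + N0)%N)).
    apply/(ym (n + N0)%N) => //; apply: le_trans pz _; apply: le_trans rhoN0 _.
    by rewrite ler_nat leq_addl.
  have -> : q (m (n + N0)%N) = q (z + m (n + N0)%N) - q z.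
    by rewrite raddfD/= addrC addKr.
  apply: le_trans (ler_normB _ _) _; rewrite addrC lerD//.
    exact: WB Wz.
  exact: W'B W'z.
have [w _ wP] := compact_seq_cluster (ps_compact pqS (r := _)) mB.
have {}wP eps N : 0 < eps -> exists2 n, (N <= n)%N & `|q (m n) - w| < eps.
  move=> eps0; have [n Nn nw] := wP _ N eps0.
  by exists (n + N0)%N => //; apply: leq_trans Nn (leq_addr _ _).
exists w; last exact: wP.
move=> i; apply/seteqP; split => h.
  move=> W'h; exists (h - w); last by rewrite subrK.
  (* Exchanging the windows moves the centres to [y n + p (m n)] and reverses the displacements. *)
  apply: (@limit_subset _ W' W (fun n => y n + p (m n)) (fun n => - m n)) => //.
    move=> n j g pg W'g; apply/(ym n); last by rewrite subrK.
    by rewrite raddfB/= -addrA -opprD [p _ + y n]addrC.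
  move=> eps N eps0; have [n Nn nw] := wP _ N eps0; exists n => //.
  by rewrite raddfN/= -opprD normrN.
move=> [h' Wh' <-]; apply: (limit_subset rW rW' _ wP Wh').
by move=> n j g pg /(ym n _ _ pg).
Qed.

(** The centres [x] and [x'] are arbitrary. Giving up [rho] of the radius moves them to
    corresponding pattern points, whose lattice coordinates supply the displacements for
    [limit_translate]. *)
Lemma common_patches_translate l (W W' : 'I_l -> set H) :
  regular_window W -> regular_window W' ->
  (forall r, exists x x', agree (nball r) (model_set W) x (model_set W') x') ->
  exists w, forall i, W' i = translate w (W i).
Proof.
move=> rW rW' ag.
have [rho _ [i0 rhoP]] := model_set_dense rW.
have /choice[am amP] : forall n : nat, exists am : 'rV[int]_k * 'rV[int]_k,
    agree (nball n%:R) (model_set W) (p am.1) (model_set W') (p am.2).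
  move=> n; have [x [x' xx']] := ag (n%:R + rho).
  have [z pz Wz] := rhoP x.
  have : model_set W' i0 (x' + (p z - x)).
    by apply/xx' => //=; rewrite ?subrKC ?model_setE// ler_wpDl.
  move=> /model_set_img[a' x'a' _]; exists (z, a') => /=.
  rewrite -x'a' -(subrKC x (p z)) -[n%:R](addrK rho).
  by rewrite [x + _ - x]addrAC subrr add0r; apply: agree_shift.
have [w ? _] : exists2 w, (forall i, W' i = translate w (W i)) &
    forall eps N, 0 < eps ->
    exists2 n, (N <= n)%N & `|q ((am n).2 - (am n).1) - w| < eps.
  apply: (@limit_translate _ W W' (fun n => p (am n).1)) => // n i g pg.
  have := amP n i (p g - p (am n).1) pg; rewrite subrKC -!model_setE => ->.
  by rewrite -raddfB -raddfD/= addrCA addrA.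
by exists w.
Qed.

(** Internal displacements of returns of ever larger patches cluster at a period [w] of the window.
    A nonempty bounded set has no nonzero period, so the displacements cannot all stay above
    [del]. *)
Lemma model_set_rigid l (W : 'I_l -> set H) del : regular_window W -> 0 < del ->
  exists r, forall x m, agree (nball r) (model_set W) x (model_set W) (x + p m) ->
    `|q m| < del.
Proof.
move=> rW del0; apply: contrapT => /forallNP nP.
have /choice[xm xmP] : forall n : nat, exists xm : V * 'rV[int]_k,
    agree (nball n%:R) (model_set W) xm.1 (model_set W) (xm.1 + p xm.2) /\
    del <= `|q xm.2|.
  move=> n; have /existsNP[x /existsNP[m /not_implyP[ag /negP]]] := nP n%:R.
  by rewrite -leNgt; exists (x, m).
have [|w Ww wP] := @limit_translate _ W W (fun n => (xm n).1) (fun n => (xm n).2) rW rW.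
  move=> n i g pg; have := (xmP n).1 i (p g - (xm n).1) pg.
  rewrite [(xm n).1 + p _]addrC -addrA !subrKC.
  by rewrite -raddfD/= addrC !model_setE.
have : w = 0.
  have [B _ WB] := family_norm_bounded (let: And3 c _ _ := rW in c).
  have [_ _ [i [h Wh]]] := rW.
  have Wn n : W i (h + w *+ n).
    elim: n => [|n IH]; first by rewrite mulr0n addr0.
    by rewrite Ww mulrSr addrA; exists (h + w *+ n).
  apply/eqP; rewrite -normr_eq0; apply/negP => /negP w0.
  have w1 : 0 < `|w| by rewrite lt_def w0 normr_ge0.
  have [n nP'] := nat_ub ((B + `|h| + 1) / `|w|).
  have : `|w *+ n| <= B + `|h|.
    have -> : w *+ n = (h + w *+ n) - h by rewrite addrC addKr.
    by apply: le_trans (ler_normB _ _) _; rewrite lerD// (WB i).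
  apply/negP; rewrite -ltNge normrMn -[ltRHS]mulr_natl.
  by apply: (@lt_le_trans _ _ (B + `|h| + 1)); [rewrite ltrDl|rewrite -ler_pdivrMr].
move=> w0; have [n _] := wP del 0%N del0; rewrite w0 subr0.
by apply/negP; rewrite -leNgt (xmP n).2.
Qed.

Lemma model_set_return l (W : 'I_l -> set H) : regular_window W ->
  exists r, forall x v, agree (nball r) (model_set W) x (model_set W) (x + v) ->
    exists m, v = p m.
Proof.
move=> /model_set_dense[rho _ [i0 rhoP]]; exists rho => x v ag.
have [z pz Wz] := rhoP x.
have : model_set W i0 (x + v + (p z - x)).
  by apply/ag => //=; rewrite subrKC model_setE.
move=> /model_set_img[a va _]; exists (a - z); rewrite raddfB/= -va.
by rewrite [x + v]addrC -[v + x + _]addrA subrKC addrK.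
Qed.

End ProjectionScheme.

(** This turns finite local complexity into an explicit list: [F] holds the candidate patches, and
    each one that occurs receives one representative. *)
Lemma finite_representatives (T : eqType) (T' : eqType) (A : T -> Prop)
    (rel : T -> T' -> Prop) (F : seq T') :
  exists s : seq T, (forall x, x \in s -> A x) /\
    forall x y, A x -> y \in F -> rel x y -> exists2 x', x' \in s & rel x' y.
Proof.
elim: F => [|y0 F [s [sA sP]]]; first by exists [::].
have [[x0 [Ax0 x0y0]]|nx0] := pselect (exists x, A x /\ rel x y0).
  exists (x0 :: s); split=> [x|x y Ax].
    by rewrite inE => /predU1P[->//|/sA].
  rewrite inE => /predU1P[->|yF] xy; first by exists x0; rewrite ?mem_head.
  by have [x' x's ?] := sP _ _ Ax yF xy; exists x'; rewrite // inE x's orbT.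
exists s; split=> // x y Ax; rewrite inE => /predU1P[->|yF] xy.
  by case: nx0; exists x.
exact: sP xy.
Qed.

Lemma finite_min_eps (R : realType) (T : eqType) (s : seq T) (Q : T -> R -> Prop) :
  (forall x e e', Q x e -> e' <= e -> Q x e') ->
  (forall x, x \in s -> exists2 e, 0 < e & Q x e) ->
  exists2 e, 0 < e & forall x, x \in s -> Q x e.
Proof.
move=> Qdown; elim: s => [|x s IH] sQ; first by exists 1.
have [|e e0 eQ] := IH; first by move=> y ys; apply: sQ; rewrite inE ys orbT.
have [|e' e'0 xQ] := sQ x; first exact: mem_head.
exists (Num.min e e'); first by rewrite lt_min e0.
move=> y; rewrite inE => /predU1P[->|ys].
  by apply: Qdown xQ _; rewrite ge_min lexx orbT.
by apply: Qdown (eQ _ ys) _; rewrite ge_min lexx.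
Qed.

Section ModelSets.
Variables (R : realType) (V H : normedModType R) (k : nat).
Variables (p : {additive 'rV[int]_k -> V}) (q : {additive 'rV[int]_k -> H}).
Hypothesis pqS : projection_scheme p q.
Variables (l : nat) (W : 'I_l -> set H).
Hypothesis rW : regular_window W.
Let P := model_set p q W.

(** For uniform discreteness, two points at distance at most 1 differ by a lattice vector whose
    internal part is bounded by the window; there are finitely many such vectors, so the nonzero
    ones have a least length. *)
Lemma model_set_delone : delone P.
Proof.
split; last first.
  have [rho _ [i rhoP]] := model_set_dense pqS rW; exists rho => x.
  have [z pz Wz] := rhoP x; exists (p z); last by rewrite distrC.
  by exists i => //; exists z.
have [B B0 WB] := family_norm_bounded (let: And3 c _ _ := rW in c).
have [s sP] := ps_discrete pqS (1 + (B + B)).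
have [|z zs|e e0 eP] := @finite_min_eps R _ s (fun z e => z <> 0 -> e <= `|p z|).
- by move=> x e e' H1 e'e /H1; apply: le_trans.
- have [->|/eqP z0] := eqVneq z 0; first by exists 1.
  exists `|p z| => //; rewrite normr_gt0; apply/eqP => pz0; apply: z0.
  by apply: (ps_inj pqS); rewrite pz0 raddf0.
exists (Num.min 1 e); first by rewrite lt_min ltr01.
move=> _ _ [i _ [z Wz <-]] [j _ [z' Wz' <-]] zz'.
have [pz|pz] := leP `|p z - p z'| 1; last by rewrite ge_min (ltW pz).
rewrite ge_min; apply/orP; right; rewrite -raddfB; apply: eP; last first.
  by move=> /eqP; rewrite subr_eq0 => /eqP zz; apply: zz'; rewrite zz.
apply: sP; rewrite raddfB/=.
  by apply: le_trans pz _; rewrite lerDl addr_ge0 ?ltW.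
apply: le_trans (ler_normB _ _) _; apply: ler_wpDl => //.
by rewrite lerD// (WB _ _ Wz, WB _ _ Wz').
Qed.

(** Finite local complexity: the points near [p a] differ from it by vectors in a fixed finite list
    [zs], so the patch is the finite subset [f a]. *)
Lemma model_set_flc r : exists s : seq 'rV[int]_k,
  (forall a, a \in s -> exists i, W i (q a)) /\
  forall i a, W i (q a) -> exists2 b, b \in s & agree (nball r) P (p a) P (p b).
Proof.
have [B B0 WB] := family_norm_bounded (let: And3 c _ _ := rW in c).
have [zs zsP] := ps_discrete pqS (Num.max r (B + B)).
pose f a : {set 'I_l * seq_sub zs} := finset (fun x => `[< W x.1 (q (a + val x.2)) >]).
have fP a b : f a = f b -> (exists i, W i (q a)) ->
    forall i u, nball r u -> P i (p a + u) -> P i (p b + u).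
  move=> fab [j Wj] i u /= ur /model_set_img[c cE Wc].
  have uE : u = p (c - a) by rewrite raddfB/= -cE addrC addKr.
  have cs : c - a \in zs.
    apply: zsP; first by rewrite -uE le_max ur.
    rewrite raddfB/= le_max; apply/orP; right.
    by apply: le_trans (ler_normB _ _) _; rewrite lerD// (WB _ _ Wc, WB _ _ Wj).
  have : (i, SeqSub cs) \in f a by rewrite inE /= subrKC; apply/asboolP.
  rewrite fab inE /= => /asboolP Wb.
  by rewrite uE -raddfD; apply/(model_setE pqS).
have [s [sW sP]] := @finite_representatives _ _ (fun a => exists i, W i (q a))
  (fun a x => f a = x) (enum {set 'I_l * seq_sub zs}).
exists s; split=> // i a Wa.
have aW : exists i, W i (q a) by exists i.
have [|//|b bs fba] := sP a (f a) aW; first by rewrite mem_enum.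
exists b => // j u ur; split; apply: fP => //; exact: sW.
Qed.

(** Only finitely many lattice vectors matter for the patch. Non-singularity puts each of their
    internal parts either in the interior of a window or at positive distance from it, and a small
    shift changes neither case. *)
Lemma model_set_robust r :
  (forall i z, ~ (closure (W i) `\` interior (W i)) (q z)) ->
  exists2 eps, 0 < eps &
    forall g, `|q g| < eps -> agree (nball r) P 0 P (p g).
Proof.
move=> nsW.
have [B B0 WB] := family_norm_bounded (let: And3 c _ _ := rW in c).
(* The margin 1 covers [|q g| < 1]: a vector with internal part beyond [B + 1] cannot be shifted
   into the window. *)
have [zs zsP] := ps_discrete pqS (Num.max r (B + 1)).
have [|z zzs|e e0 eP] := @finite_min_eps R _ zs
    (fun z e => forall i h, `|h| < e -> W i (q z) <-> W i (q z + h)).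
- by move=> z e e' H1 e'e i h he; apply: H1; apply: lt_le_trans he e'e.
- have [|i _|e e0 eP] := @finite_min_eps R _ (enum 'I_l)
      (fun i e => forall h, `|h| < e -> W i (q z) <-> W i (q z + h)).
  + by move=> i e e' H1 e'e h he; apply: H1; apply: lt_le_trans he e'e.
  + have clW := regular_window_closure i rW.
    have := nsW i z; rewrite clW => /not_andP[nWz|/contrapT].
      have : ~ closure (W i) (q z) by rewrite clW.
      move=> /closure_normP/existsNP[e /not_implyP[e0 eW]].
      exists e => // h he; split=> // Wh; case: eW; exists (q z + h) => //.
      by rewrite opprD addNKr normrN.
    move=> Wi; have [e e0 eW] := (interior_normP _ _).1 Wi; exists e => // h he.
    split=> _; last exact: interior_subset Wi.
    by apply: eW; rewrite opprD addNKr normrN.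
  by exists e => // i h; apply: eP; rewrite mem_enum.
exists (Num.min 1 e); first by rewrite lt_min ltr01.
move=> g; rewrite lt_min => /andP[g1 ge] i u /= ur; rewrite add0r.
have key z : u = p z -> W i (q z) <-> W i (q z + q g).
  move=> uz; have [qz|qz] := leP `|q z| (B + 1).
    by apply: eP => //; apply: zsP; rewrite le_max ?qz ?orbT// -uz ur.
  split=> Wz.
    by have := le_lt_trans (WB _ _ Wz) (lt_trans _ qz); rewrite ltxx ltrDl ltr01 => /(_ isT).
  suff : `|q z| < `|q z| by rewrite ltxx.
  apply: le_lt_trans qz; rewrite -[q z](addrK (q g)).
  by apply: le_trans (ler_normB _ _) _; rewrite lerD ?(WB _ _ Wz)// ltW.
split=> [/model_set_img[z uz Wz]|].
  rewrite uz -raddfD; apply/(model_setE pqS); rewrite raddfD/= addrC.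
  exact/key.
move=> /model_set_img[c cE Wc].
have uE : u = p (c - g) by rewrite raddfB/= -cE addrC addKr.
rewrite uE; apply/(model_setE pqS)/key => //.
by rewrite raddfB/= subrK.
Qed.

(** The internally small vectors generate the lattice: the segment from [0] to [q z] is followed in
    short steps through lattice approximations, and the last difference is again small. *)
Lemma small_generate eps (G : 'rV[int]_k -> Prop) : 0 < eps ->
  (forall z, `|q z| < eps -> G z) -> (forall z z', G z -> G z' -> G (z + z')) ->
  forall z, G z.
Proof.
move=> eps0 Gs GD z.
(* One third for the length of a step, one for each of its two approximated ends. *)
have eps3 : 0 < eps / 3 by rewrite divr_gt0.
have [N NP] := nat_ub (`|q z| / (eps / 3)).
have step : `|N.+1%:R^-1 *: q z| < eps / 3.
  rewrite normrZ gtr0_norm ?invr_gt0// mulrC ltr_pdivrMr//.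
  move: NP; rewrite ler_pdivrMr// mulrC => /le_lt_trans; apply.
  by rewrite ltr_pM2l// ltr_nat.
have [zN GzN zNP] : exists2 zN, G zN & `|q zN - q z| < eps / 3.
  suff : forall j : nat, exists2 zj, G zj & `|q zj - (j%:R / N.+1%:R) *: q z| < eps / 3.
    by move=> /(_ N.+1); rewrite divff ?pnatr_eq0// scale1r.
  elim=> [|j [zj Gzj zjP]].
    exists 0; first by apply: Gs; rewrite raddf0 normr0.
    by rewrite raddf0 mul0r scale0r subrr normr0.
  have [z' z'P] := ps_dense pqS ((j.+1%:R / N.+1%:R) *: q z) eps3.
  exists z' => //; rewrite -(subrKC zj z'); apply: GD => //; apply: Gs.
  rewrite raddfB/=; apply: le_lt_trans (norm_triangle _ ((j.+1%:R / N.+1%:R) *: q z) _) _.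
  apply: le_lt_trans (lerD (lexx _) (norm_triangle _ ((j%:R / N.+1%:R) *: q z) _)) _.
  have -> : eps = eps / 3 + (eps / 3 + eps / 3) by field.
  rewrite ltrD// ltrD//; last by rewrite distrC.
  by rewrite -scalerBl -mulrBl -natrB// subSnn mul1r.
rewrite -(subrKC zN z); apply: GD => //; apply: Gs.
rewrite raddfB/= distrC; apply: lt_trans zNP _.
by rewrite ltr_pdivrMr// ltr_pMr// ltr1n.
Qed.

End ModelSets.

(** * Supertile hierarchies *)

(** The factor [C] is present because [Li] contracts only eventually in the given norm. [Lam] bounds
    how fast patches grow, which fixes the radius required along a hierarchy. *)
Record expansion (R : realType) (V : normedModType R) (L Li : V -> V)
    (Lam C theta : R) : Prop := Expansion {
  ex_L : linear L;
  ex_Li : linear Li;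
  ex_LLi : cancel Li L;
  ex_LiL : cancel L Li;
  ex_Lam1 : 1 <= Lam;
  ex_Lam : forall v, `|L v| <= Lam * `|v|;
  ex_C0 : 0 < C;
  ex_theta0 : 0 < theta;
  ex_theta1 : theta < 1;
  ex_decay : forall n v, `|iter n Li v| <= C * theta ^+ n * `|v| }.

(* [P] is obtained from [L P'] by a local rule of radius [c], read in the
   coordinates of [P'], and every patch of [P'] occurs in [P]. *)
Record derived_pair (R : realType) (V : normedModType R) (L : V -> V) l (c : R)
    (P P' : pattern V l) : Prop := DerivedPair {
  dp_li : forall r x, exists y, agree (nball r) P' x P y;
  dp_ld : forall z z', agree (nball c) P' z P' z' ->
    forall i, P i (L z) <-> P i (L z') }.

Section Chains.
Variables (R : realType) (V : normedModType R) (L Li : V -> V).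
Variables (Lam C theta : R).
Hypothesis LE : expansion L Li Lam C theta.

Let L0 : L 0 = 0.
Proof. by have := ex_L LE (-1) 0 0; rewrite scaler0 addr0 scaleN1r addNr. Qed.
Let LD x y : L (x + y) = L x + L y.
Proof. by have := ex_L LE 1 x y; rewrite !scale1r. Qed.
Let LiD x y : Li (x + y) = Li x + Li y.
Proof. by have := ex_Li LE 1 x y; rewrite !scale1r. Qed.

Let Lam0 : 0 < Lam. Proof. exact: lt_le_trans ltr01 (ex_Lam1 LE). Qed.
Let C0 := ex_C0 LE.
Let theta0 := ex_theta0 LE.
Let theta1 := ex_theta1 LE.

Lemma iter_LD n x y : iter n L (x + y) = iter n L x + iter n L y.
Proof. by elim: n => //= n ->; rewrite LD. Qed.

Lemma iter_LiD n x y : iter n Li (x + y) = iter n Li x + iter n Li y.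
Proof. by elim: n => //= n ->; rewrite LiD. Qed.

Lemma iter_LLi n : cancel (iter n Li) (iter n L).
Proof.
by elim: n => // n IH x; rewrite iterSr [iter n.+1 Li x]iterS (ex_LLi LE) IH.
Qed.

Lemma iter_LiL n : cancel (iter n L) (iter n Li).
Proof.
by elim: n => // n IH x; rewrite iterSr [iter n.+1 L x]iterS (ex_LiL LE) IH.
Qed.

Lemma iter_L_le n v : `|iter n L v| <= Lam ^+ n * `|v|.
Proof.
elim: n => [|n IH]; first by rewrite mul1r.
rewrite iterS exprS -mulrA; apply: le_trans (ex_Lam LE _) _.
by rewrite ler_wpM2l// ltW.
Qed.

Lemma decay_small r eps : 0 < eps ->
  exists N, forall n, (N <= n)%N -> C * theta ^+ n * r <= eps.
Proof.
move=> eps0.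
have th : theta ^+ n @[n --> \oo] --> (0 : R).
  by apply: cvg_expr; rewrite gtr0_norm.
have e0 : 0 < eps / (C * (`|r| + 1)) by rewrite divr_gt0// mulr_gt0// ltr_wpDl.
have /cvgrPdist_le/(_ _ e0)[N _ NP] := th.
exists N => n /NP /=.
rewrite sub0r normrN ger0_norm => [thn|]; last by rewrite exprn_ge0// ltW.
have cr : 0 < C * (`|r| + 1) by rewrite mulr_gt0// ltr_wpDl.
move: thn; rewrite ler_pdivlMr//; apply: le_trans.
rewrite mulrCA mulrA ler_wpM2l//.
  by rewrite mulr_ge0 ?exprn_ge0 ?ltW.
by apply: le_trans (ler_norm _) _; rewrite lerDl.
Qed.

Section Pair.
Variables (l : nat).
Implicit Types (P Q : pattern V l).

(** [P] at [x0 = L z] is derived from [P'] at [z]; replacing that patch of [P'] by its copy in [P]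
    at [x1] lets the next step start from [P] again. *)
Definition step P (P' : pattern V l) (r : R) (x1 x0 : V) :=
  exists2 z, x0 = L z & agree (nball r) P' z P x1.

(* A supertile hierarchy: around [x0], [P] looks like [n] substitutions applied
   to [P] around [y]. *)
Fixpoint chain P (P' : pattern V l) (n : nat) (r : R) (y x0 : V) : Prop :=
  if n is n'.+1 then exists2 x1, chain P P' n' r y x1 & step P P' r x1 x0
  else y = x0.

Lemma chain_exists P P' c n r x0 : derived_pair L c P P' ->
  exists y, chain P P' n r y x0.
Proof.
move=> dp; elim: n x0 => [|n IH] x0; first by exists x0.
have [x1 x1P] := dp_li dp r (Li x0).
have [y yx1] := IH x1; exists y, x1 => //.
by exists (Li x0); rewrite // (ex_LLi LE).
Qed.

Lemma chain_le P P' n r s y x0 : s <= r ->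
  chain P P' n r y x0 -> chain P P' n s y x0.
Proof.
move=> sr; elim: n x0 => // n IH x0 [x1 /IH yx1 [z x0z ag]].
by exists x1 => //; exists z => //; apply: agree_le ag.
Qed.

(** A shift [v] of the seed becomes [L^j v] at level [j]; since [1 <= Lam], the single loss [T] pays
    for all levels. *)
Lemma chain_shift P P' n r T v y x0 : Lam ^+ n * `|v| <= T ->
  chain P P' n r y x0 -> chain P P' n (r - T) (y + v) (x0 + iter n L v).
Proof.
elim: n x0 => [|n IH] x0; first by move=> _ /= ->.
move=> vT [x1 yx1 [z x0z ag]].
have vT' : Lam ^+ n * `|v| <= T.
  apply: le_trans vT; rewrite ler_wpM2r//.
  by rewrite ler_weXn2l// (ex_Lam1 LE).
exists (x1 + iter n L v); first exact: IH.
exists (z + iter n L v); first by rewrite LD x0z.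
by apply: agree_shift ag; apply: le_trans vT'; exact: iter_L_le.
Qed.

Section Compare.
Variables (c sig : R).
Hypotheses (c0 : 0 <= c) (sig0 : 0 <= sig).

(** The second term is the tail from [n] on of the series of [c * C * theta ^+ j]: the margins lost
    by the remaining applications of the local rule. [sig] is the reserve left at the end. *)
Definition core_radius n := sig + c * C * theta ^+ n / (1 - theta).

Let th1 : 0 < 1 - theta. Proof. by rewrite subr_gt0. Qed.

Lemma core_radiusS n :
  core_radius n.+1 + C * theta ^+ n * c = core_radius n.
Proof. by rewrite /core_radius exprS; field; apply: lt0r_neq0. Qed.

Lemma core_radius_ge n : sig <= core_radius n.
Proof.
rewrite lerDl; apply: divr_ge0; last exact: ltW.
by rewrite !mulr_ge0 ?exprn_ge0// ltW.
Qed.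

Lemma core_radius_le n : core_radius n <= core_radius 0.
Proof.
elim: n => // n; apply: le_trans; rewrite -[leRHS]core_radiusS lerDl.
by rewrite mulr_ge0// mulr_ge0 ?exprn_ge0// ltW.
Qed.

(** The local rule at a point consumes a [c]-ball one level down. Measured in seed coordinates this
    ball has radius at most [C * theta ^+ n * c], exactly the drop of [core_radius]. The bound on
    [r] keeps every region inside the balls copied along the chains. *)
Lemma chain_agree_core P P' Q Q' n r y x y' x' :
  (forall z z', agree (nball c) P' z Q' z' ->
     forall i, P i (L z) <-> Q i (L z')) ->
  chain P P' n r y x -> chain Q Q' n r y' x' ->
  agree (nball (core_radius 0)) P y Q y' -> Lam ^+ n * core_radius 0 <= r ->
  agree [set u | `|iter n Li u| <= core_radius n] P x Q x'.
Proof.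
move=> cross yx yx' ag; elim: n x x' yx yx' => [|n IH] x x'.
  by move=> /= <- <- _.
move=> [x1 yx1 [z -> ag1]] [x1' yx1' [z' -> ag1']] rn i u /=.
rewrite -iterS iterSr => un.
have un' : Lam ^+ n * core_radius 0 <= r.
  apply: le_trans rn; rewrite ler_wpM2r ?ler_weXn2l ?(ex_Lam1 LE)//.
  exact: le_trans (core_radius_ge 0).
rewrite -[u](ex_LLi LE) -!LD; apply: cross => j b /= bc.
rewrite -!addrA.
have wn : `|iter n Li (Li u + b)| <= core_radius n.
  rewrite iter_LiD -core_radiusS; apply: le_trans (ler_normD _ _) _.
  rewrite lerD//; apply: le_trans (ex_decay LE _ _) _.
  by rewrite ler_wpM2l// mulr_ge0 ?exprn_ge0// ltW.
have wr : `|Li u + b| <= r.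
  rewrite -[Li u + b](iter_LLi n); apply: le_trans (iter_L_le _ _) _.
  apply: le_trans un'; rewrite ler_wpM2l ?exprn_ge0//; first exact: ltW.
  exact: le_trans wn (core_radius_le _).
rewrite ag1// ag1'//; exact: IH.
Qed.

(** The radius [t] may grow like [theta ^- n] while the seed patch stays fixed: this is how
    arbitrarily large patches arise from bounded data. *)
Lemma chain_agree P P' Q Q' n r y x y' x' t :
  (forall z z', agree (nball c) P' z Q' z' ->
     forall i, P i (L z) <-> Q i (L z')) ->
  chain P P' n r y x -> chain Q Q' n r y' x' ->
  agree (nball (core_radius 0)) P y Q y' -> Lam ^+ n * core_radius 0 <= r ->
  C * theta ^+ n * t <= sig -> agree (nball t) P x Q x'.
Proof.
move=> cross yx yx' ag rn tn.
apply: agree_subset (chain_agree_core cross yx yx' ag rn) => u /= ut.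
apply: le_trans (ex_decay LE _ _) _; apply: le_trans (core_radius_ge _).
by apply: le_trans tn; rewrite ler_wpM2l// mulr_ge0 ?exprn_ge0// ltW.
Qed.

End Compare.
End Pair.
End Chains.

Lemma linear_bounded_eq0 (R : realType) (V : lmodType R) (X : normedModType R)
    (f : V -> X) (B : R) :
  linear f -> (forall v, `|f v| <= B) -> forall v, f v = 0.
Proof.
move=> lf fB v; apply/eqP; rewrite -normr_eq0; apply/negP => /negP fv0.
have f1 : 0 < `|f v| by rewrite lt_def fv0 normr_ge0.
have [n nP] := nat_ub ((B + 1) / `|f v|).
have fn : f (n%:R *: v) = n%:R *: f v.
  have f0 : f 0 = 0 by have := lf (-1) 0 0; rewrite scaler0 addr0 scaleN1r addNr.
  by have := lf n%:R v 0; rewrite f0 !addr0.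
have := fB (n%:R *: v); rewrite fn normrZ normr_nat.
move: nP; rewrite ler_pdivrMr// => nP nB.
by have := le_trans nP nB; rewrite gerDl ler10.
Qed.

Lemma seq_norm_bounded (R : realType) (X : normedModType R) (T : eqType)
  (f : T -> X) (s : seq T) : exists2 B, 0 <= B & forall a, a \in s -> `|f a| <= B.
Proof.
elim: s => [|a s [B B0 IH]]; first by exists 0.
exists (`|f a| + B); first by rewrite addr_ge0.
move=> b; rewrite inE => /predU1P[->|/IH bs]; first by rewrite lerDl.
by apply: le_trans bs _; rewrite lerDr.
Qed.

Lemma pigeonhole_seq (T : eqType) (s : seq T) (Q : nat -> T -> Prop) :
  (forall m n b, (m <= n)%N -> Q n b -> Q m b) ->
  (forall n, exists2 b, b \in s & Q n b) ->
  exists2 b, b \in s & forall n, Q n b.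
Proof.
move=> Qle sQ; apply: contrapT => nQ.
have [N NP] : exists N, forall b, b \in s -> ~ Q N b.
  have : forall b, b \in s -> ~ forall n, Q n b by move=> b bs Qb; apply: nQ; exists b.
  elim: {sQ nQ} s => [|a s IH] nQ; first by exists 0%N.
  have [|N NP] := IH; first by move=> b bs; apply: nQ; rewrite inE bs orbT.
  have /existsNP[n nQa] := nQ a (mem_head _ _).
  exists (maxn n N) => b; rewrite inE => /predU1P[->|bs] Qb.
    by apply: nQa; apply: Qle Qb; rewrite leq_maxl.
  by apply: (NP b bs); apply: Qle Qb; rewrite leq_maxr.
by have [b bs] := sQ N; exact: NP.
Qed.

(** * Lifting the expansive map to the lattice *)

Section Substitution.
Variables (R : realType) (V H : normedModType R) (k : nat).
Variables (p : {additive 'rV[int]_k -> V}) (q : {additive 'rV[int]_k -> H}).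
Hypothesis pqS : projection_scheme p q.
Variables (L Li : V -> V) (Lam C theta : R).
Hypothesis LE : expansion L Li Lam C theta.

Let L0 : L 0 = 0.
Proof. by have := ex_L LE (-1) 0 0; rewrite scaler0 addr0 scaleN1r addNr. Qed.
Let LD x y : L (x + y) = L x + L y.
Proof. by have := ex_L LE 1 x y; rewrite !scale1r. Qed.
Let Lam0 : 0 < Lam. Proof. exact: lt_le_trans ltr01 (ex_Lam1 LE). Qed.
Let C0 := ex_C0 LE.
Let theta0 := ex_theta0 LE.
Let theta1 := ex_theta1 LE.

Section Window.
Variables (l : nat) (W : 'I_l -> set H).
Hypothesis rW : regular_window W.
Let P := model_set p q W.

Section Lift.
Hypothesis nsW : forall i z, ~ (closure (W i) `\` interior (W i)) (q z).
Variables (c : R) (P' : pattern V l).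
Hypotheses (c0 : 0 <= c) (PP' : derived_pair L c P P').

(** The point is that [eps] does not depend on [n]. Near the seed of a chain there is a lattice
    point [p a] with [q a] small; the seed patches at [p a] and [p a + p g] agree, and both chains
    are grown from them. *)
Lemma small_returns sig : 0 <= sig -> exists2 eps, 0 < eps &
  forall n g, `|q g| < eps -> exists x, forall t, C * theta ^+ n * t <= sig ->
    agree (nball t) P x P (x + iter n L (p g)).
Proof.
move=> sig0; have [e e0 eP] := model_set_robust pqS rW (core_radius C theta c sig 0) nsW.
have e2 : 0 < e / 2 by rewrite divr_gt0.
exists (e / 2) => // n g ge.
have [rho rho0 rhoP] := uniform_density pqS e2.
(* [T] pays for moving the seed from [y] to [p a] and to [p a + p g]. *)
set s0 := core_radius C theta c sig 0; set T := Lam ^+ n * (rho + `|p g|).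
have [y y0] := chain_exists LE n (Lam ^+ n * s0 + T) 0 PP'.
have [a [pa]] := rhoP y 0; rewrite subr0 => qa.
have Ln : 0 <= Lam ^+ n by rewrite exprn_ge0// ltW.
exists (0 + iter n L (p a - y)) => t tn.
rewrite -addrA -(iter_LD LE).
apply: (@chain_agree _ _ _ _ _ _ _ LE _ c sig c0 sig0 _ _ _ _ n (Lam ^+ n * s0)
  (y + (p a - y)) _ (y + (p a - y + p g)) _ t (dp_ld PP') _ _ _ _ tn) => //.
- rewrite -[Lam ^+ n * s0](addrK T); apply: (chain_shift LE) y0.
  by rewrite ler_wpM2l// (le_trans pa)// lerDl.
- rewrite -[Lam ^+ n * s0](addrK T); apply: (chain_shift LE) y0.
  by rewrite ler_wpM2l// (le_trans (ler_normD _ _))// lerD2r.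
(* Both patches agree with the one at [0], since [q a] and [q a + q g] are below [e]. *)
rewrite [y + (p a - y + p g)]addrA subrKC -raddfD.
apply: (agree_trans (agree_sym (eP a _))).
  by rewrite (lt_trans qa)// ltr_pdivrMr// ltr_pMr// ltr1n.
apply: eP; rewrite raddfD/= [e]splitr.
by apply: le_lt_trans (ler_normD _ _) _; rewrite ltrD.
Qed.

(** [L] sends internally small vectors to returns, hence to lattice vectors, and these generate.
    Iterates give returns of growing patches, so rigidity forces [q (M^n z)] to [0], first for small
    [z], then for sums. *)
Lemma lattice_lift : exists M : {additive 'rV[int]_k -> 'rV[int]_k},
  [/\ forall z, L (p z) = p (M z),
      exists2 eps, 0 < eps & forall z, `|q z| < eps -> `|q (M z)| < 1 &
      forall z del, 0 < del ->
        exists N, forall n, (N <= n)%N -> `|q (iter n M z)| < del].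
Proof.
have [r1 r1P] := model_set_return pqS rW.
have [r2 r2P] := model_set_rigid pqS rW ltr01.
(* With reserve [C * rm], patches of radius [r1] and [r2] repeat for every [n], because
   [theta ^+ n <= 1]. *)
set rm := `|r1| + `|r2| + 1.
have rm0 : 0 < rm by rewrite ltr_wpDl// addr_ge0.
have Crm : 0 < C * rm by rewrite mulr_gt0.
have [eps eps0 epsP] := small_returns (ltW Crm).
have tP n t : t <= rm -> C * theta ^+ n * t <= C * rm.
  move=> tr; rewrite -mulrA ler_wpM2l//; first exact: ltW.
  apply: (@le_trans _ _ (theta ^+ n * rm)).
    by rewrite ler_wpM2l// exprn_ge0// ltW.
  by rewrite ler_piMl ?exprn_ile1// ltW.
have r1m : r1 <= rm by rewrite (le_trans (ler_norm _))// /rm -addrA lerDl addr_ge0.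
have r2m : r2 <= rm.
  by rewrite (le_trans (ler_norm _))// /rm addrAC addrC lerDl addr_ge0.
have /choice[M MP] : forall z, exists m, L (p z) = p m.
  apply: (small_generate pqS eps0) => [z zeps|z z' [m mP] [m' m'P]].
    have [x /(_ r1) xP] := epsP 1%N z zeps; apply: (r1P x); apply: xP; exact: tP.
  by exists (m + m'); rewrite !raddfD/= LD mP m'P.
have MD z z' : M (z + z') = M z + M z'.
  by apply: (ps_inj pqS); rewrite raddfD/= -!MP raddfD/= LD.
have MnD n z z' : iter n M (z + z') = iter n M z + iter n M z'.
  by elim: n => //= n ->; rewrite MD.
have iP n z : iter n L (p z) = p (iter n M z) by elim: n => //= n ->; rewrite MP.
have MB : zmod_morphism M.
  by move=> z z'; apply/(addIr (M z')); rewrite -MD !subrK.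
pose M' : {additive 'rV[int]_k -> 'rV[int]_k} := HB.pack M
  (GRing.isZmodMorphism.Build _ _ M MB).
exists M'; split; first exact: MP.
  exists eps => // z zeps; have [x /(_ r2) xP] := epsP 1%N z zeps.
  by apply: (r2P x); rewrite -MP; apply: xP; exact: tP.
apply: (small_generate pqS eps0) => [z zeps del del0|z z' Gz Gz' del del0].
  have [r3 r3P] := model_set_rigid pqS rW del0.
  have [N NP] := decay_small LE r3 Crm; exists N => n Nn.
  have [x /(_ r3 (NP _ Nn))] := epsP n z zeps.
  by rewrite iP; exact: r3P.
have del2 : 0 < del / 2 by rewrite divr_gt0.
have [N NP] := Gz _ del2; have [N' N'P] := Gz' _ del2.
exists (maxn N N') => n; rewrite geq_max => /andP[Nn N'n].
rewrite MnD raddfD/= [del]splitr; apply: le_lt_trans (ler_normD _ _) _.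
by rewrite ltrD ?NP ?N'P.
Qed.

End Lift.
End Window.
End Substitution.

(** * Coding windows *)

Section Coding.
Variables (R : realType) (V H : normedModType R) (k : nat).
Variables (p : {additive 'rV[int]_k -> V}) (q : {additive 'rV[int]_k -> H}).
Hypothesis pqS : projection_scheme p q.

(** Indices are stored as natural numbers so that the type of codes does not depend on [l]. Lattice
    coordinates replace real points. *)
Definition lists_patch l (r : R) (Q : pattern V l) (s : seq (nat * 'rV[int]_k)) :=
  forall i z, `|p z| <= r -> (nat_of_ord i, z) \in s <-> Q i (p z).

Lemma lists_patch_exists l (r : R) (Q : pattern V l) (B : R) :
  (forall i z, Q i (p z) -> `|p z| <= r -> `|q z| <= B) ->
  exists s, lists_patch r Q s.
Proof.
move=> QB; have [zs zsP] := ps_discrete pqS (Num.max r B).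
exists (flatten [seq [seq (nat_of_ord i, z) | z <- zs & `[< Q i (p z) >]] | i <- enum 'I_l]).
move=> i z pz; split.
  move=> /flattenP[t /mapP[j _ ->] /mapP[z' + [/val_inj -> ->]]].
  by rewrite mem_filter => /andP[/asboolP].
move=> Qz; apply/flattenP; eexists.
  by apply/mapP; exists i; rewrite ?mem_enum.
apply: map_f; rewrite mem_filter; apply/andP; split; first exact/asboolP.
by apply: zsP; rewrite le_max ?pz// (QB i) ?orbT.
Qed.

Variables (L Li : V -> V) (Lam C theta : R).
Hypothesis LE : expansion L Li Lam C theta.

Let LD x y : L (x + y) = L x + L y.
Proof. by have := ex_L LE 1 x y; rewrite !scale1r. Qed.
Let Lam0 : 0 < Lam. Proof. exact: lt_le_trans ltr01 (ex_Lam1 LE). Qed.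

(* The finite data [sP], [sP'] determine the local rule, and the patch at [ys]
   is the seed from which arbitrarily large patches of [P] are grown. *)
Definition substitution_code l (W : 'I_l -> set H)
    (c s0 rho : nat) (ys : 'rV[int]_k) (sP sP' : seq (nat * 'rV[int]_k)) :=
  let P := model_set p q W in
  exists P' : pattern V l,
  [/\ (forall i v, P' i v -> exists z, v = p z) /\ derived_pair L c%:R P P',
      forall z, exists z0, [/\ `|z0| + c%:R <= rho%:R, `|L z0| <= rho%:R &
        agree (nball c%:R) P' z P' z0],
      `|p ys| + s0%:R <= rho%:R,
      forall n r, exists y x0, chain L P P' n r y x0 /\
        agree (nball s0%:R) P y P (p ys) &
      lists_patch rho%:R P sP /\ lists_patch rho%:R P' sP'].

Lemma lists_patch_agree l r (Q Q' : pattern V l) s :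
  (forall i v, Q i v -> exists z, v = p z) ->
  (forall i v, Q' i v -> exists z, v = p z) ->
  lists_patch r Q s -> lists_patch r Q' s ->
  forall i v, `|v| <= r -> Q i v <-> Q' i v.
Proof.
move=> Qp Q'p Qs Q's i v vr; split.
  by move=> Qv; have [z vz] := Qp _ _ Qv; move: vr Qv; rewrite vz => zr /(Qs i z zr)/(Q's i z zr).
by move=> Qv; have [z vz] := Q'p _ _ Qv; move: vr Qv; rewrite vz => zr /(Q's i z zr)/(Qs i z zr).
Qed.

(** Equal lists give equal seeds and equal local rules, so chains for [W] and [W'] grow identical
    patches of any radius [t]; the constants of a single expansion serve both. *)
Lemma same_code_translate l (W W' : 'I_l -> set H) c s0 rho ys sP sP' :
  regular_window W -> regular_window W' ->
  core_radius C theta c%:R 1 0 <= s0%:R ->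
  substitution_code W c s0 rho ys sP sP' ->
  substitution_code W' c s0 rho ys sP sP' ->
  exists w, forall i, W' i = translate w (W i).
Proof.
move=> rW rW' core_s0.
move=> [P' [[P'p PP'] nearP ysP seedP [sPP sPP']]].
move=> [Q' [[Q'p QQ'] _ _ seedQ [sPQ sPQ']]].
set P := model_set p q W in PP' seedP sPP *.
set Q := model_set p q W' in QQ' seedQ sPQ *.
have Pp i v : P i v -> exists z, v = p z by move=> /model_set_img[z]; exists z.
have Qp i v : Q i v -> exists z, v = p z by move=> /model_set_img[z]; exists z.
have PQ := lists_patch_agree Pp Qp sPP sPQ.
have P'Q' := lists_patch_agree P'p Q'p sPP' sPQ'.
(* Every [c]-patch of [P'] occurs at some [z0] inside the listed region, where the patterns for [W]
   and [W'] coincide; the rule is read off there. *)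
have cross z z' : agree (nball c%:R) P' z Q' z' ->
    forall i, P i (L z) <-> Q i (L z').
  move=> zz' i; have [z0 [z0c Lz0 zz0]] := nearP z.
  rewrite (dp_ld PP' zz0) PQ//; apply: (dp_ld QQ').
  apply: agree_trans zz'; apply: agree_trans (agree_sym zz0) => j u /= uc.
  apply: iff_sym; apply: P'Q'; apply: le_trans z0c.
  by apply: le_trans (ler_normD _ _) _; rewrite lerD2l.
apply: (common_patches_translate pqS rW rW') => t.
have [n nP] := decay_small LE t (ltr01 (R := R)).
have {}nP := nP n (leqnn n).
set r := Lam ^+ n * core_radius C theta c%:R 1 0.
have [y [x [yx yP]]] := seedP n r.
have [y' [x' [yx' yQ]]] := seedQ n r.
exists x, x'.
apply: (chain_agree LE (ler0n R c) (ler01 (R := R)) cross yx yx' _ (lexx r) nP).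
apply: agree_le core_s0 _; apply: agree_trans yP _.
apply: agree_trans (agree_sym yQ) => i u /= us; apply: PQ.
apply: le_trans ysP.
by apply: le_trans (ler_normD _ _) _; rewrite lerD2l.
Qed.

Lemma chain_trunc l (P P' : pattern V l) m n r y x0 : (m <= n)%N ->
  chain L P P' n r y x0 -> exists x, chain L P P' m r y x.
Proof.
elim: n x0 => [|n IH] x0; first by rewrite leqn0 => /eqP ->; exists x0.
by rewrite leq_eqVlt => /predU1P[->|/IH{}IH [x1 /IH]//] ?; exists x0.
Qed.

Lemma substitution_code_exists l (W : 'I_l -> set H) (c0 : R) (P0 : pattern V l) :
  regular_window W -> 0 <= c0 -> delone P0 ->
  derived_pair L c0 (model_set p q W) P0 ->
  exists c s0 rho ys sP sP', core_radius C theta c%:R 1 0 <= s0%:R /\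
    substitution_code W c s0 rho ys sP sP'.
Proof.
move=> rW c00 [_ [rho0 P0dense]] PP0.
set P := model_set p q W.
have [B B0 WB] := family_norm_bounded (let: And3 c _ _ := rW in c).
have [v0 [j0 _ P0v0] _] := P0dense 0.
(* Translating a point of [P0] to the origin makes every point of [P'] a difference of two points of
   [P], hence a projected lattice vector. The rule radius grows by [|v0|]. *)
pose P' : pattern V l := fun i => [set v | P0 i (v + v0)].
have P'0 : P' j0 0 by rewrite /P' /= add0r.
have [c cP] := nat_ub (c0 + `|v0|).
have PP' : derived_pair L c%:R P P'.
  split.
    move=> r x; have [y xy] := dp_li PP0 r (x + v0); exists y => i u /= ur.
    by have := xy i u ur; rewrite addrAC.
  move=> z z' zz'; apply: (dp_ld PP0) => i u /= uc.
  have := zz' i (u - v0); rewrite /P' /= -!addrA addNr addr0; apply.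
  by apply: le_trans (ler_normB _ _) _; apply: le_trans cP; rewrite lerD2r.
have P'P i v : P' i v -> exists a b, [/\ v = p (b - a), W j0 (q a) & W i (q b)].
  move=> P'v; have [y yP] := dp_li PP' `|v| 0.
  have /model_set_img[a ya Wa] : P j0 y by rewrite -[y]addr0 -yP/= ?addr0// normr0.
  have /model_set_img[b yb Wb] : P i (y + v) by rewrite -yP/= ?add0r.
  by exists a, b; rewrite raddfB/= -yb -ya addrC addKr.
have P'p i v : P' i v -> exists z, v = p z.
  by move=> /P'P[a [b [-> _ _]]]; exists (b - a).
have P'B i z : P' i (p z) -> `|q z| <= B + B.
  move=> /P'P[a [b [/(ps_inj pqS) -> Wa Wb]]]; rewrite raddfB/=.
  by apply: le_trans (ler_normB _ _) _; rewrite lerD// (WB _ _ Wa, WB _ _ Wb).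
have P'dense v : exists i a, P' i (p a) /\ `|p a - v| <= rho0.
  have [y [i _ P0y] yv] := P0dense (v + v0); exists i.
  have : P' i (y - v0) by rewrite /P' /= subrK.
  move=> /[dup] /P'p[a ya] P'y; exists a; split; first by rewrite -ya.
  by rewrite -ya -addrA -opprD [v0 + v]addrC distrC.
(* A [c]-ball around any [z] lies in a [C1]-ball around a point of [P'] within [rho0] of [z]. *)
set C1 := c%:R + rho0.
have [s1 [s1W s1P]] := model_set_flc pqS rW C1.
have [s2 [s2P' s2P]] := finite_representatives (fun a => exists i, P' i (p a))
  (fun a b => agree (nball C1) P' (p a) P (p b)) s1.
have rho00 : 0 <= rho0.
  by have [i [a [_]]] := P'dense 0; apply: le_trans.
have near2 a i : P' i (p a) ->
    exists2 a', a' \in s2 & agree (nball C1) P' (p a) P' (p a').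
  move=> P'a; have [y yP] := dp_li PP' C1 (p a).
  have /model_set_img[a1 ya1 Wa1] : P i y.
    by have := yP i 0; rewrite !addr0 /= normr0 => <-//; rewrite addr_ge0.
  have [b bs1 ab] := s1P _ _ Wa1.
  have P'ab : agree (nball C1) P' (p a) P (p b).
    by apply: agree_trans yP _; rewrite ya1.
  have [a' a's2 a'b] := s2P a b (ex_intro _ i P'a) bs1 P'ab.
  by exists a' => //; apply: agree_trans P'ab (agree_sym a'b).
have [B2 B20 s2B] := seq_norm_bounded p s2.
have [s0 s0P] := nat_ub (core_radius C theta c%:R 1 0).
have [s3 [s3W s3P]] := model_set_flc pqS rW s0%:R.
have [B3 B30 s3B] := seq_norm_bounded p s3.
have [rho1 rho10 [i1 rho1P]] := model_set_dense pqS rW.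
(* Truncating a chain keeps its seed, so a seed good for depth [n] is good for smaller depths, and
   one of the finitely many seed patches serves all depths. *)
have [|n|ys yss3 ysP] := @pigeonhole_seq _ s3 (fun n b =>
    exists y x0, chain L P P' n n%:R y x0 /\ agree (nball s0%:R) P y P (p b)).
- move=> m n b mn [y [x0 [yx0 yb]]]; have [x yx] := chain_trunc mn yx0.
  by exists y, x; split=> //; apply: chain_le yx; rewrite ler_nat.
- have [y yx] := chain_exists LE n (n%:R + Lam ^+ n * rho1) 0 PP'.
  have [z zy Wz] := rho1P y; have [b bs3 zb] := s3P _ _ Wz.
  exists b => //; exists (p z), (0 + iter n L (p z - y)); split=> //.
  rewrite -{1}(subrKC y (p z)) -[n%:R](addrK (Lam ^+ n * rho1)).
  apply: (chain_shift LE) yx; rewrite ler_wpM2l// exprn_ge0//; exact: ltW.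
(* The listed region must contain the [c]-balls around the representatives [z0], their images
   [L z0], and the seed patch. *)
have [rho rhoP] := nat_ub (Num.max (Lam * (B2 + rho0) + c%:R + (B2 + rho0)) (B3 + s0%:R)).
have [sP sPP] : exists sP, lists_patch rho%:R P sP.
  apply: (@lists_patch_exists _ _ _ B) => i z /(model_setE pqS) Wz _.
  exact: WB Wz.
have [sP' sP'P'] : exists sP', lists_patch rho%:R P' sP'.
  by apply: (@lists_patch_exists _ _ _ (B + B)) => i z P'z _; exact: P'B P'z.
exists c, s0, rho, ys, sP, sP'; split=> //; exists P'; split=> //.
- move=> z; have [i [a [P'a az]]] := P'dense z.
  have [a' a's2 aa'] := near2 _ _ P'a.
  have zB : `|p a' + (z - p a)| <= B2 + rho0.
    by apply: le_trans (ler_normD _ _) _; rewrite lerD ?s2B// distrC.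
  have Brho0 : 0 <= B2 + rho0 by rewrite addr_ge0.
  move: rhoP; rewrite ge_max => /andP[rhoP _].
  exists (p a' + (z - p a)); split.
  + apply: le_trans rhoP; rewrite addrC; apply: lerD => //.
    by rewrite lerDr mulr_ge0// ltW.
  + apply: le_trans rhoP; apply: le_trans (ex_Lam LE _) _.
    rewrite -addrA ler_wpDr ?addr_ge0// ler_wpM2l//; exact: ltW.
  + rewrite -{1}(subrKC (p a) z) -[c%:R](addrK rho0).
    by apply: agree_shift aa'; rewrite distrC.
- move: rhoP; rewrite ge_max => /andP[_]; apply: le_trans.
  by rewrite lerD2r s3B.
- move=> n r; have [N rN] := nat_ub r; have [y [x0 [yx0 yys]]] := ysP (maxn n N).
  have [x yx] := chain_trunc (leq_maxl n N) yx0; exists y, x; split=> //.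
  by apply: chain_le yx; apply: le_trans rN _; rewrite ler_nat leq_maxr.
Qed.

End Coding.

(** * Expansive maps *)

Definition geom_bounded (R : realType) (a : nat -> R) :=
  exists C theta : R,
    [/\ 0 < C, 0 < theta < 1 & forall n, a n <= C * theta ^+ n].

(** Any rate [t] strictly between the maximum of [mu], [th] and 1 works: the gap [t - mu] absorbs
    the forcing term [d], which explains the constant [C / (t - mu)]. *)
Lemma geom_bounded_rec (R : realType) (a d : nat -> R) (mu : R) :
  0 <= mu < 1 -> (forall n, a n.+1 <= mu * (a n + d n)) ->
  geom_bounded d -> geom_bounded a.
Proof.
move=> /andP[mu0 mu1] ad [C [th [C0 /andP[th0 th1] dth]]].
pose m := Num.max mu th; pose t := (1 + m) / 2.
have m1 : m < 1 by rewrite gt_max mu1.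
have mt : m < t by rewrite ltr_pdivlMr// mulr_natr mulr2n ltrD2r.
have t1 : t < 1 by rewrite ltr_pdivrMr// mul1r -[2]/(1 + 1) ltrD2l.
have m0 : 0 < m by rewrite lt_max th0 orbT.
have mut : 0 < t - mu by rewrite subr_gt0; apply: le_lt_trans mt; rewrite le_max lexx.
have tht : th <= t by apply: le_trans (ltW mt); rewrite le_max lexx orbT.
have t0 : 0 < t by apply: lt_trans mt.
have C'0 : 0 < `|a 0%N| + C / (t - mu) by rewrite ltr_wpDl// divr_gt0.
exists (`|a 0%N| + C / (t - mu)), t; split; [exact: C'0|by rewrite t0|].
elim=> [|n IH].
  rewrite expr0 mulr1; apply: le_trans (ler_norm _) _; rewrite lerDl.
  by apply: divr_ge0; exact: ltW.
apply: le_trans (ad n) _.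
have dn : d n <= C * t ^+ n.
  apply: le_trans (dth n) _; rewrite ler_wpM2l ?(ltW C0)//.
  by apply: lerXn2r; rewrite // nnegrE ltW.
apply: le_trans (ler_wpM2l mu0 (lerD IH dn)) _.
rewrite -mulrDl mulrA exprS [leRHS]mulrA ler_wpM2r ?exprn_ge0 ?(ltW t0)//.
set E := `|a 0%N| + C / (t - mu).
have EC : C <= E * (t - mu) by rewrite -ler_pdivrMr// /E lerDr.
have : mu * C <= C by rewrite ler_piMl ?(ltW C0) ?(ltW mu1).
move: EC; rewrite mulrBr mulrDr => EC muC.
by rewrite (mulrC mu E); lra.
Qed.

Section MatrixNorm.
Import ComplexField.
Variable (R : realType).
Local Notation K := (complex R).
Local Notation nu := (@Normc.normc R).

Lemma normc_ge0 (z : K) : 0 <= nu z.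
Proof. by case: z => x y; exact: sqrtr_ge0. Qed.

Definition csum n (M : 'M[K]_n) : R := \sum_i \sum_j nu (M i j).

Lemma csumD n (M N : 'M[K]_n) : csum (M + N) <= csum M + csum N.
Proof.
rewrite /csum -big_split ler_sum//= => i _; rewrite -big_split ler_sum//= => j _.
rewrite mxE; exact: le_normcD.
Qed.

Lemma csumZ n a (M : 'M[K]_n) : csum (a *: M) = nu a * csum M.
Proof.
rewrite /csum mulr_sumr; apply: eq_bigr => i _.
by rewrite mulr_sumr; apply: eq_bigr => j _; rewrite mxE Normc.normcM.
Qed.

Lemma csumB n (M N : 'M[K]_n) : csum (M - N) <= csum M + csum N.
Proof.
rewrite -scaleN1r; apply: le_trans (csumD _ _) _.
by rewrite csumZ normcN Normc.normc1 mul1r.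
Qed.

Lemma csum0 n : csum (0 : 'M[K]_n) = 0.
Proof.
by rewrite /csum big1// => i _; rewrite big1// => j _; rewrite mxE Normc.normc0.
Qed.

Lemma char_roots_gt1 n (A : 'M[K]_n) :
  (forall a, eigenvalue A a -> 1 < nu a) ->
  exists2 s : seq K, char_poly A = \prod_(z <- s) ('X - z%:P) &
    forall z, z \in s -> 1 < nu z.
Proof.
move=> Aeig; have [s sE] := closed_field_poly_normal (char_poly A).
move: sE; rewrite (monicP (char_poly_monic A)) scale1r => sE.
exists s => // z zs; apply: Aeig.
by rewrite eigenvalue_root_char sE root_prod_XsubC.
Qed.

(** Jordan forms are avoided. By Cayley-Hamilton the full product of the factors [A - z] vanishes;
    the factors are then removed one at a time. With [u m = g(A) B^m] one has
    [z u(m+1) = u(m) - g(A)(A - z) B^(m+1)], a recursion of ratio [1/|z| < 1]. *)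
Lemma inverse_decay n (A B : 'M[K]_n.+1) : A *m B = 1%:M ->
  (forall a, eigenvalue A a -> 1 < nu a) -> geom_bounded (fun m => csum (B ^+ m)).
Proof.
move=> AB /char_roots_gt1[s sE s1].
suff gb (g : {poly K}) : geom_bounded (fun m =>
    csum (horner_mx A (g * \prod_(z <- s) ('X - z%:P)) * B ^+ m)) ->
    geom_bounded (fun m => csum (horner_mx A g * B ^+ m)).
  have := gb 1; rewrite mul1r -sE Cayley_Hamilton rmorph1 => {}gb.
  suff : geom_bounded (fun m => csum (1 * B ^+ m)) by under eq_fun do rewrite mul1r.
  apply: gb; exists 1, (1/2); split=> //; first by apply/andP; split; lra.
  by move=> m; rewrite mul0r csum0 mul1r exprn_ge0// divr_ge0.
elim: s {sE} s1 g => [|z s IH] s1 g; first by rewrite big_nil mulr1.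
rewrite big_cons mulrA => /IH{}IH.
have /IH : forall z, z \in s -> 1 < nu z by move=> x xs; apply: s1; rewrite inE xs orbT.
have z1 : 1 < nu z by apply: s1; rewrite mem_head.
have z0 : 0 < nu z by apply: lt_trans z1.
move=> [C [th [C0 thb gth]]].
apply: (@geom_bounded_rec _ _ (fun m => csum (horner_mx A (g * ('X - z%:P)) * B ^+ m.+1))
    (nu z)^-1).
- by rewrite invr_ge0 (ltW z0) invf_lt1.
- move=> m; rewrite -ler_pdivrMl ?invr_gt0// invrK -csumZ.
  have -> : z *: (horner_mx A g * B ^+ m.+1) =
      horner_mx A g * B ^+ m - horner_mx A (g * ('X - z%:P)) * B ^+ m.+1.
    rewrite rmorphM/= rmorphB/= horner_mx_X horner_mx_C mulrBr mulrBl opprB.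
    rewrite -[horner_mx A g * A * _]mulrA exprS [A * (B * _)]mulrA.
    rewrite [A * B]AB mul1r addrC subrK -mulrA -[z%:M * _]/(z%:M *m _).
    by rewrite mul_scalar_mx -scalerAr.
  exact: csumB.
exists (C * th), th; split=> //; first by rewrite mulr_gt0// (andP thb).1.
by move=> m; rewrite -mulrA -exprS.
Qed.

End MatrixNorm.

Section RealMatrix.
Import ComplexField.
Variable (R : realType).

Lemma normc_real (x : R) : Normc.normc (real_complex R x) = `|x|.
Proof. by rewrite /= expr0n /= addr0 sqrtr_sqr. Qed.

Lemma mx_norm_mul_le n (v : 'rV[R]_n) (M : 'M[R]_n) :
  `|v *m M| <= csum (map_mx (real_complex R) M) * `|v|.
Proof.
have csM0 : 0 <= csum (map_mx (real_complex R) M).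
  by apply: sumr_ge0 => i _; apply: sumr_ge0 => j _; exact: normc_ge0.
rewrite [X in X <= _]/normr /= mx_normrE; apply/bigmax_leP; split.
  by rewrite mulr_ge0.
move=> [i j] _ /=; rewrite ord1 mxE mulr_suml.
apply: le_trans (ler_norm_sum _ _ _) _; apply: ler_sum => a _.
rewrite normrM mulrC; apply: ler_pM => //; last exact: mx_norm_coord.
rewrite (bigD1 j)//= mxE normc_real lerDl.
by apply: sumr_ge0 => ? _; exact: normc_ge0.
Qed.

Lemma row_decay n (A : 'M[R]_n) :
  (forall a, eigenvalue (map_mx (real_complex R) A) a -> 1 < `|a|) ->
  exists B C theta, [/\ A *m B = 1%:M, B *m A = 1%:M, 0 < C, 0 < theta < 1 &
    forall m (v : 'rV[R]_n), `|iter m (mulmxr B) v| <= C * theta ^+ m * `|v|].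
Proof.
(* Powers of matrices live in size [n.+1], so dimension 0 is treated apart. *)
case: n A => [|n] A Aeig.
  exists 0, 1, (1 / 2); rewrite !flatmx0; split=> //; first by apply/andP; split; lra.
  move=> m v; have th : 0 <= (1 / 2 : R) by lra.
  by rewrite (thinmx0 (iter _ _ _)) normr0 !mulr_ge0// exprn_ge0.
have nueig a : eigenvalue (map_mx (real_complex R) A) a -> 1 < Normc.normc a.
  by move=> /Aeig; rewrite -[`|a|]/((Normc.normc a)%:C)%C -[1]/(1%:C)%C ltcR.
have Au : A \in unitmx.
  rewrite unitmxE unitfE; apply/negP => /eqP det0.
  have : root (char_poly (map_mx (real_complex R) A)) 0.
    rewrite rootE horner_coef0 char_poly_det.
    by rewrite (det_map_mx (real_complex R)) det0 rmorph0 mulr0.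
  rewrite -eigenvalue_root_char => /nueig.
  by rewrite Normc.normc0 ltNge ler01.
have AB : map_mx (real_complex R) A *m map_mx (real_complex R) (invmx A) = 1%:M.
  by rewrite -map_mxM/= mulmxV// map_mx1.
have [C [th [C0 thb CP]]] := inverse_decay AB nueig.
exists (invmx A), C, th; rewrite mulmxV// mulVmx//; split=> // m v.
have -> : iter m (mulmxr (invmx A)) v = v *m (invmx A ^+ m).
  elim: m => [|m IH] /=; first by rewrite mulmx1.
  by rewrite IH exprSr mulmxA.
apply: le_trans (mx_norm_mul_le _ _) _; rewrite ler_wpM2r//.
by apply: le_trans (CP m); rewrite rmorphXn.
Qed.

End RealMatrix.

Lemma expansive_expansion (R : realType) (U : vectType R) (L : 'End(normed U)) :
  expansive L -> exists Li Lam C theta,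
  @expansion R (normed U) (L : normed U -> normed U) Li Lam C theta.
Proof.
move=> /row_decay[B [C [th [AB BA C0 /andP[th0 th1] CP]]]].
set e := vbasis {:normed U} in AB BA.
have eb : basis_of {:normed U} e by exact: vbasisP.
pose Li (v : normed U) : normed U := vecof e (rVof e v *m B).
have [Lam Lam0 LamP] := @linear_bounded R U (normed U) (L : U -> normed U) (linearP L).
have iterLi m v : iter m Li v = vecof e (iter m (mulmxr B) (rVof e v)).
  elim: m => [|m IH] /=; first by rewrite rVofK.
  by rewrite IH /Li vecofK.
have [K1 K10 K1P] := @linear_bounded R U _ (rVof e : U -> 'rV_(\dim {:normed U}))
  (linearP (rVof e)).
pose K2 := 1 + \sum_(i < \dim {:normed U}) `|e`_i : normed U|.
have K20 : 0 < K2 by rewrite ltr_pwDl// sumr_ge0.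
have K2P w : `|vecof e w : normed U| <= K2 * `|w|.
  rewrite /vecof /K2 mulrDl mul1r; apply: ler_wpDl => //.
  apply: le_trans (ler_norm_sum _ _ _) _; rewrite mulr_suml; apply: ler_sum => i _.
  by rewrite normrZ mulrC ler_wpM2l// mx_norm_coord.
(* Adding 1 ensures [1 <= Lam]; [K1] and [K2] pass between vectors and coordinates. *)
exists Li, (1 + Lam), (K2 * C * K1), th; split=> //.
- exact: linearP.
- by move=> a x y; rewrite /Li linearP/= mulmxDl -scalemxAl linearP.
- by move=> v; rewrite /Li (hom_vecof e eb) -mulmxA BA mulmx1 rVofK.
- by move=> v; rewrite /Li (rVof_app e eb) -mulmxA AB mulmx1 rVofK.
- by rewrite lerDl ltW.
- by move=> v; rewrite mulrDl mul1r; apply: le_trans (LamP v) _; rewrite lerDr.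
- by rewrite !mulr_gt0.
move=> n v; rewrite iterLi; apply: le_trans (K2P _) _.
rewrite -!mulrA ler_wpM2l//; first exact: ltW.
apply: le_trans (CP n _) _; rewrite -mulrA ler_wpM2l//; first exact: ltW.
rewrite [leRHS]mulrCA ler_wpM2l ?exprn_ge0//; first exact: ltW.
Qed.

(** * Euclidean cut and project schemes *)

Section ConcreteScheme.
Variables (R : realType) (S : scheme R).
Local Notation E := (Defs.total S).

Lemma physical_proj_linear : linear (@physical_proj R S).
Proof. by move=> a x y; rewrite /physical_proj /proj_along !linearP. Qed.

Lemma internal_proj_linear : linear (@internal_proj R S).
Proof. by move=> a x y; rewrite /internal_proj /proj_along !linearP. Qed.

HB.instance Definition _ := GRing.isLinear.Build R E (physical_space S) _
  (@physical_proj R S) physical_proj_linear.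
HB.instance Definition _ := GRing.isLinear.Build R E (internal_space S) _
  (@internal_proj R S) internal_proj_linear.

Lemma proj_decomp (x : E) : vsval (physical_proj x) + vsval (internal_proj x) = x.
Proof.
rewrite /physical_proj /internal_proj /proj_along !vsprojK ?memv_pi//.
by rewrite daddv_pi_add ?physical_internal_cap// physical_internal_sum memvf.
Qed.

Lemma physical_projK (v : physical_space S) : physical_proj (vsval v) = v.
Proof.
rewrite /physical_proj /proj_along daddv_pi_id ?physical_internal_cap ?subvsP//.
exact: vsvalK.
Qed.

Lemma internal_projK (h : internal_space S) : internal_proj (vsval h) = h.
Proof.
rewrite /internal_proj /proj_along daddv_pi_id ?subvsP//; first exact: vsvalK.
by rewrite capvC physical_internal_cap.
Qed.

Lemma internal_proj_physical (v : physical_space S) : internal_proj (vsval v) = 0.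
Proof.
apply: val_inj; apply: (addrI (vsval (physical_proj (vsval v)))).
by rewrite proj_decomp physical_projK linear0 addr0.
Qed.

Lemma physical_proj_internal (h : internal_space S) : physical_proj (vsval h) = 0.
Proof.
apply: val_inj; apply: (addIr (vsval (internal_proj (vsval h)))).
by rewrite proj_decomp internal_projK linear0 add0r.
Qed.

Lemma internal_proj_eq0 (x : E) : internal_proj x = 0 <-> x \in physical S.
Proof.
split=> [x0|xP]; first by rewrite -(proj_decomp x) x0 linear0 addr0 subvsP.
by rewrite -(vsprojK xP) internal_proj_physical.
Qed.

Lemma physical_proj_eq0 (x : E) : physical_proj x = 0 <-> x \in internal S.
Proof.
split=> [x0|xP]; first by rewrite -(proj_decomp x) x0 linear0 add0r subvsP.
by rewrite -(vsprojK xP) physical_proj_internal.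
Qed.

End ConcreteScheme.

(** * Schemes in lattice coordinates *)

Section LatticeCoordinates.
Variables (R : realType) (E : vectType R) (k : nat) (b : k.-tuple E).

Definition lattice_point (z : 'rV[int]_k) : E := \sum_(i < k) b`_i *~ z ord0 i.

Lemma lattice_point_additive : zmod_morphism lattice_point.
Proof.
move=> z z'; rewrite /lattice_point -sumrB; apply: eq_bigr => i _.
by rewrite !mxE mulrzBr.
Qed.

HB.instance Definition _ := GRing.isZmodMorphism.Build _ _ lattice_point
  lattice_point_additive.

Lemma coord_lattice_point z i : free b -> coord b i (lattice_point z) = (z ord0 i)%:~R.
Proof.
move=> bf; rewrite /lattice_point linear_sum/= (bigD1 i)//= big1 => [|j ji].
  by rewrite raddfMz/= coord_free// eqxx addr0.
by rewrite raddfMz/= coord_free// (negbTE ji) mul0rz.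
Qed.

End LatticeCoordinates.

Section SchemeProjections.
Variables (R : realType) (S : scheme R).
Local Notation E := (Defs.total S).
Variables (k : nat) (b : k.-tuple E).

Definition phys_pt : 'rV[int]_k -> physical_space S :=
  @physical_proj R S \o lattice_point b.
Definition int_pt : 'rV[int]_k -> internal_space S :=
  @internal_proj R S \o lattice_point b.
HB.instance Definition _ := GRing.Additive.on phys_pt.
HB.instance Definition _ := GRing.Additive.on int_pt.

Hypothesis bB : basis_of {:E} b.
Hypothesis bL : lattice S = range (lattice_point b).

Let bf : free b. Proof. exact: basis_free bB. Qed.

Lemma lattice_point_mem z : lattice S (lattice_point b z).
Proof. by rewrite bL; exists z. Qed.

Lemma lattice_point_inj : injective (lattice_point b).
Proof.
move=> z z' zz'; apply/rowP => i; apply/eqP; rewrite -(eqr_int R).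
by rewrite -!(coord_lattice_point _ _ bf) zz'.
Qed.

Lemma bounded_rows_finite n (N : nat) : exists s : seq 'rV[int]_n,
  forall z : 'rV[int]_n, (forall i, (`|z ord0 i| <= N)%N) -> z \in s.
Proof.
exists [seq map_mx (fun x : 'I_(N + N).+1 => Posz x - Posz N) y | y <- enum {: 'rV['I_(N + N).+1]_n}].
move=> z zN; apply/mapP.
exists (map_mx (fun x : int => inord (absz (x + Posz N)) : 'I_(N + N).+1) z).
  by rewrite mem_enum.
apply/rowP => i; rewrite !mxE; move: (z ord0 i) (zN i) => x xN.
have x0 : 0 <= x + Posz N by lia.
by rewrite inordK; lia.
Qed.

Lemma scheme_projection : projection_scheme phys_pt int_pt.
Proof.
split.
- move=> z z' /= zz'; apply: lattice_point_inj.
  apply: (physical_proj_inj (s := S)) => //; exact/mem_set/lattice_point_mem.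
- move=> h eps eps0.
  have h0 : (ball h eps) !=set0 by exists h; exact: ballxx.
  have [y [hg [g + gE]]] := @internal_proj_dense R S _ h0 (ball_open h eps).
  rewrite bL => -[z _ zg]; exists z; move: hg.
  by rewrite -gE -zg -ball_normE /= distrC.
- move=> C.
  (* Each coordinate of a vector is the sum of linear functions of its two projections, so bounds on
     these bound it. *)
  have /choice[A AP] : forall i : 'I_k, exists A : R, forall z,
      `|phys_pt z| <= C -> `|int_pt z| <= C -> `|(z ord0 i)%:~R : R| <= A.
    move=> i.
    have [|A1 A10 A1P] := @linear_bounded R _ R^o
        (fun v : subvs_of (physical S) => coord b i (vsval v)).
      by move=> a x y; rewrite !linearP.
    have [|A2 A20 A2P] := @linear_bounded R _ R^o
        (fun v : subvs_of (internal S) => coord b i (vsval v)).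
      by move=> a x y; rewrite !linearP.
    exists (A1 * C + A2 * C) => z pz qz.
    rewrite -(coord_lattice_point _ _ bf) -[lattice_point b z]proj_decomp.
    rewrite linearD/=; apply: le_trans (ler_normD _ _) _; apply: lerD.
      by apply: le_trans (A1P _) _; rewrite ler_wpM2l// ltW.
    by apply: le_trans (A2P _) _; rewrite ler_wpM2l// ltW.
  have [N NP] := nat_ub (\sum_i `|A i| : R^o).
  have [s sP] := bounded_rows_finite k N; exists s => z pz qz; apply: sP => i.
  rewrite -(ler_nat R) natr_absz intr_norm; apply: le_trans NP.
  apply: le_trans (AP i z pz qz) _; apply: le_trans (ler_norm _) _.
  by rewrite (bigD1 i)//= lerDl sumr_ge0.
- exists (\sum_(i < k) `|physical_proj b`_i| + \sum_(i < k) `|internal_proj b`_i|).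
  move=> v h; pose x : E := vsval v + vsval h.
  have px : physical_proj x = v.
    by rewrite /x linearD/= physical_projK physical_proj_internal addr0.
  have qx : internal_proj x = h.
    by rewrite /x linearD/= internal_projK internal_proj_physical add0r.
  (* Rounding coordinates down leaves a remainder in a fundamental parallelepiped. *)
  pose z : 'rV[int]_k := \row_i Num.floor (coord b i x).
  pose d i := (Num.floor (coord b i x))%:~R - coord b i x.
  have xz : lattice_point b z - x = \sum_(i < k) d i *: b`_i.
    rewrite [x in LHS](coord_basis bB (memvf x)) /lattice_point -sumrB.
    by apply: eq_bigr => i _; rewrite mxE scalerBl scaler_int.
  have d1 i : `|d i| <= 1.
    rewrite distrC ger0_norm ?subr_ge0 ?floor_le//.
    by rewrite lerBlDl; have /ltW := floorD1_gt (coord b i x); rewrite intrD.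
  exists z; split.
    rewrite -px -[X in X <= _]/(`|physical_proj (lattice_point b z) - physical_proj x|).
    rewrite -linearB xz linear_sum/=.
    apply: le_trans (ler_norm_sum _ _ _) _; apply: ler_wpDr; first exact: sumr_ge0.
    by apply: ler_sum => i _; rewrite linearZ/= normrZ ler_piMl.
  rewrite -qx -[X in X <= _]/(`|internal_proj (lattice_point b z) - internal_proj x|).
    rewrite -linearB xz linear_sum/=.
  apply: le_trans (ler_norm_sum _ _ _) _; apply: ler_wpDl; first exact: sumr_ge0.
  by apply: ler_sum => i _; rewrite linearZ/= normrZ ler_piMl.
move=> r; exact: closed_ball_compact.
Qed.

End SchemeProjections.

(** * Translates and non-singular windows *)

Section Translates.
Variables (R : realType) (X : normedModType R).
Implicit Types (A : set X) (s : X).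

Lemma translateE s A x : translate s A x <-> A (x - s).
Proof.
by split=> [[y Ay <-]|Ax]; [rewrite addrK|exists (x - s); rewrite ?subrK].
Qed.

Lemma translateD s t A : translate s (translate t A) = translate (t + s) A.
Proof.
apply/seteqP; split=> x; rewrite !translateE opprD addrA addrAC => //.
Qed.

Lemma translate0 A : translate 0 A = A.
Proof. by apply/seteqP; split=> x; rewrite translateE subr0. Qed.

Lemma closure_translate s A : closure (translate s A) = translate s (closure A).
Proof.
apply/seteqP; split=> x; rewrite translateE.
  move=> /closure_normP Ax; apply/closure_normP => eps /Ax[a].
  rewrite translateE => Aa xa; exists (a - s) => //.
  by rewrite opprB addrA subrK.
move=> /closure_normP Ax; apply/closure_normP => eps /Ax[a Aa xa].
exists (a + s); first by rewrite translateE addrK.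
by rewrite opprD addrA addrAC.
Qed.

Lemma interior_translate s A : interior (translate s A) = translate s (interior A).
Proof.
apply/seteqP; split=> x; rewrite translateE.
  move=> /interior_normP[eps eps0 Ax]; apply/interior_normP; exists eps => // a xa.
  have /translateE : translate s A (a + s).
    by apply: Ax; rewrite opprD addrA addrAC.
  by rewrite addrK.
move=> /interior_normP[eps eps0 Ax]; apply/interior_normP; exists eps => // a xa.
by apply/translateE/Ax; rewrite opprB addrA subrK.
Qed.

Lemma compact_translate s A : compact A -> compact (translate s A).
Proof.
move=> cA; apply: continuous_compact => //; apply: continuous_subspaceT => x.
by apply: cvgD; [exact: cvg_id|exact: cvg_cst].
Qed.

Lemma regular_window_translate l s (W : 'I_l -> set X) :
  regular_window W -> regular_window (fun i => translate s (W i)).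
Proof.
case=> Wc Wreg [i [w Ww]]; split.
- by move=> j; exact: compact_translate.
- by move=> j; rewrite interior_translate closure_translate Wreg.
by exists i, (w + s); exists w.
Qed.

End Translates.

(* Baire: the translations to avoid form a countable union of closed nowhere
   dense sets. *)
Lemma generic_translation (R : realType) (X : completeNormedModType R) (I : countType)
    (x : I -> X) (D : I -> set X) :
  (forall i, closed (D i)) -> (forall i, interior (D i) = set0) ->
  exists s, forall i, ~ D i (x i - s).
Proof.
move=> Dcl Dint.
pose F (n : nat) : set X :=
  if @unpickle I n is Some i then [set s | ~ D i (x i - s)] else setT.
have Fod n : open (F n) /\ dense (F n).
  rewrite /F; case: unpickle => [i|]; last first.
    by split; [exact: openT|move=> O [y Oy] _; exists y].
  split.
    apply: (@open_comp _ _ (fun s => x i - s) (~` D i)); last exact: closed_openC.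
    by move=> s _; apply: cvgB; [exact: cvg_cst|exact: cvg_id].
  move=> O [y Oy] oO; apply: contrapT => nex.
  have : interior (D i) (x i - y).
    have /interior_normP[eps eps0 epsO] : interior O y by apply: open_nbhs_nbhs.
    apply/interior_normP; exists eps => // a xa; apply: contrapT => nDa.
    apply: nex; exists (x i - a); split; last by rewrite /= subKr.
    by apply: epsO; rewrite -normrN opprB addrAC.
  by rewrite Dint.
have [s [_ sF]] := @Baire R X F Fod setT (ex_intro _ (0 : X) Logic.I) openT.
by exists s => i; have := sF (pickle i) Logic.I; rewrite /F pickleK.
Qed.

Section PatchGlue.
Variables (R : realType) (V : normedModType R) (l : nat).
Implicit Types P Q : pattern V l.

Lemma centred_patchE P x r i v :
  centred_patch P x r i v <-> P i (x + v) /\ `|v| <= r.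
Proof.
rewrite /centred_patch translateE opprK addrC /= /closed_ball_ /=.
by rewrite opprD addNKr normrN.
Qed.

(** Patches of [L P'] are read in the coordinates of [P'], where a ball of radius [c] pulls back
    into one of radius [C * theta ^+ 1 * c]. A patch of radius [0] records only whether its centre
    belongs to each component. *)
Lemma derived_pair_of_L_sub (L : {linear V -> V}) (Li : V -> V) Lam C theta P P' :
  expansion L Li Lam C theta -> hull P P' ->
  locally_derivable P (fun i => L @` P' i) ->
  exists2 c, 0 <= c & derived_pair L c P P'.
Proof.
move=> LE [_ P'P] [c c0 cP].
have C0 := ex_C0 LE; have th0 := ex_theta0 LE.
exists (C * theta ^+ 1 * c); first by rewrite !mulr_ge0// ltW.
split=> [r x|z z' zz' i].
  have [t tP] : exists t, forall i, translate t (P' i `&` closed_ball_ normr x r) =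
      P i `&` translate t (closed_ball_ normr x r).
    apply: P'P; exists (`|x| + r); split; first exact: num_real.
    move=> M xM v /= xv; apply: le_trans (ltW xM).
    by rewrite -[v](subKr x); apply: le_trans (ler_normB _ _) _; rewrite lerD2l.
  exists (x + t) => i u /= ur.
  have inball : closed_ball_ normr x r (x + u).
    by rewrite /closed_ball_ /= opprD addNKr normrN.
  have xut : x + t + u - t = x + u by rewrite addrAC addrK.
  have tx : translate t (closed_ball_ normr x r) (x + t + u).
    by apply/translateE; rewrite xut.
  split=> [P'u|Pu].
    have : translate t (P' i `&` closed_ball_ normr x r) (x + t + u).
      by apply/translateE; rewrite xut.
    by rewrite tP => -[].
  have : (P i `&` translate t (closed_ball_ normr x r)) (x + t + u) by [].
  by rewrite -tP => /translateE; rewrite xut => -[].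
have LP j v w : (L @` P' j) (L v + w) <-> P' j (v + Li w).
  split=> [[u P'u Lu]|P'vw].
    suff -> : v + Li w = u by [].
    by rewrite -(ex_LiL LE (v + Li w)) linearD/= (ex_LLi LE) -Lu (ex_LiL LE).
  by exists (v + Li w) => //; rewrite linearD/= (ex_LLi LE).
have /cP zz'0 : centred_patch (fun i => L @` P' i) (L z) c =
    centred_patch (fun i => L @` P' i) (L z') c.
  apply/funext => j; apply/seteqP.
  have ball_w w : `|w| <= c -> `|Li w| <= C * theta ^+ 1 * c.
    move=> wc; apply: le_trans (ex_decay LE 1 w) _.
    by rewrite ler_wpM2l// mulr_ge0// ltW.
  by split=> w /centred_patchE[/LP P'w wc]; apply/centred_patchE; split=> //;
    apply/LP; apply/(zz' j (Li w) (ball_w _ wc)).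
have : centred_patch P (L z) 0 i 0 <-> centred_patch P (L z') 0 i 0 by rewrite zz'0.
rewrite !centred_patchE !addr0 normr0 lexx => -[zz z'z].
by split=> Pz; [case: (zz (conj Pz isT))|case: (z'z (conj Pz isT))].
Qed.

End PatchGlue.

Section SchemeWindows.
Variables (R : realType) (S : scheme R) (k : nat) (b : k.-tuple (Defs.total S)).
Hypothesis bB : basis_of {:Defs.total S} b.
Hypothesis bL : lattice S = range (lattice_point b).
Local Notation V := (physical_space S).
Local Notation H := (internal_space S).
Local Notation p := (@phys_pt R S k b).
Local Notation q := (@int_pt R S k b).
Let pqS : projection_scheme p q := scheme_projection bB bL.

Lemma cut_and_projectE l (W : 'I_l -> set H) : cut_and_project W = model_set p q W.
Proof.
apply/funext => i; apply/seteqP; split=> v.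
  by move=> [g []]; rewrite bL => -[z _ <-] Wz <-; exists z.
by move=> [z Wz <-]; exists (lattice_point b z) => //; split=> //; rewrite bL; exists z.
Qed.

Lemma nonsingularP l (W : 'I_l -> set H) : nonsingular W ->
  forall i z, ~ (closure (W i) `\` interior (W i)) (q z).
Proof.
move=> nsW i z Wz; have : set0 (q z) by rewrite -(nsW i); split=> //;
  exists (lattice_point b z) => //; rewrite bL; exists z.
by [].
Qed.

Lemma nonsingular_translation l (W : 'I_l -> set H) : is_window W ->
  exists s, nonsingular (translate_window s W).
Proof.
move=> wW; pose D (iz : 'I_l * 'rV[int]_k) := closure (W iz.1) `\` interior (W iz.1).
have [iz|iz|s sD] := @generic_translation R H _ (fun iz => q iz.2) D.
- by rewrite /D setDE; apply: closedI; [exact: closed_closure|exact/open_closedC/open_interior].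
- apply/seteqP; split=> // x Dx; have [_] : D iz x := interior_subset Dx.
  apply; apply: interiorS Dx => y [].
  by rewrite (regular_window_closure _ wW).
exists s => i; apply/seteqP; split=> // x [[g]].
rewrite bL => -[z _ <-] <-.
rewrite closure_translate interior_translate => -[/translateE Wz nWz].
by apply: (sD (i, z)); split=> //= Wz'; apply: nWz; apply/translateE.
Qed.

(** The hypothesis on the hull is applied to one element, the model set of a non-singular translate,
    which lies in its own hull. *)
Lemma sub_window_data l (W : 'I_l -> set H) : is_window W -> expansive_sub W ->
  exists s (L : 'End(V)) Li Lam C theta c P',
  [/\ regular_window (translate_window s W),
      forall i z, ~ (closure (translate_window s W i) `\`
                     interior (translate_window s W i)) (q z),
      expansion (L : V -> V) Li Lam C theta,
      0 <= c /\ delone P' &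
      derived_pair (L : V -> V) c (model_set p q (translate_window s W)) P'].
Proof.
move=> wW [L /expansive_expansion[Li [Lam [C [theta LE]]]] LW].
have [s nsW] := nonsingular_translation wW.
have rW : regular_window (translate_window s W) by exact: regular_window_translate.
have [|P' PP' LD] := LW (model_set p q (translate_window s W)).
  exists s => //; split; first exact: model_set_delone.
  by rewrite cut_and_projectE => U _; exists 0 => i; rewrite !translate0.
have [c c0 dp] := derived_pair_of_L_sub LE PP' LD.
exists s, L, Li, Lam, C, theta, c, P'; split=> //.
  exact: nonsingularP.
by split=> //; case: PP'.
Qed.

End SchemeWindows.

(** * Countability *)

(** A code may be any related element of [C]. Collecting the codes of all members of the class of
    [x] gives a set depending on the class alone, so the element chosen from it is well defined on
    classes. *)
Lemma countable_up_toP (T : Type) (e : T -> T -> Prop) (A : T -> Prop)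
    (C : countType) (Q : T -> C -> Prop) :
  (forall x, e x x) -> (forall x y, e x y -> e y x) ->
  (forall x y z, e x y -> e y z -> e x z) ->
  (forall x, A x -> exists c, Q x c) ->
  (forall x y c, A x -> A y -> Q x c -> Q y c -> e x y) ->
  countable_up_to e A.
Proof.
move=> erefl esym etrans AQ Qe.
pose codes x : set nat := [set n | exists y c, [/\ A y, e x y, Q y c & pickle c = n]].
have codes_e x y : e x y -> codes x = codes y.
  move=> xy; apply/seteqP; split=> n [z [c [Az xz Qz cn]]]; exists z, c; split=> //.
    exact: etrans (esym _ _ xy) xz.
  exact: etrans xy xz.
have codesP x : A x -> codes x (xget 0%N (codes x)).
  move=> Ax; have [c Qx] := AQ x Ax; apply: (@xgetPex _ 0%N).
  by exists (pickle c), x, c.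
exists (fun x => xget 0%N (codes x)) => x y Ax Ay; split=> [xy|/codes_e -> //].
have [z [c [Az xz Qz cn]]] := codesP x Ax.
have [z' [c' [Az' yz' Qz' cn']]] := codesP y Ay.
have cc' : c = c' by apply: (pcan_inj (@pickleK C)); rewrite cn cn' xy.
apply: (etrans _ _ _ xz); apply: etrans (esym _ _ yz').
by apply: (Qe _ _ c) => //; rewrite cc'.
Qed.

Section CountableWindows.
Variables (R : realType) (S : scheme R) (k : nat) (b : k.-tuple (Defs.total S)).
Hypothesis bB : basis_of {:Defs.total S} b.
Hypothesis bL : lattice S = range (lattice_point b).
Local Notation V := (physical_space S).
Local Notation H := (internal_space S).
Local Notation p := (@phys_pt R S k b).
Local Notation q := (@int_pt R S k b).
Let pqS : projection_scheme p q := scheme_projection bB bL.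

Lemma translation_equiv_refl (W : {l : nat & 'I_l -> set H}) : translation_equiv W W.
Proof.
exists 0; case: W => l W /=; congr existT.
by apply/funext => i; rewrite /translate_window translate0.
Qed.

Lemma translation_equiv_sym (W W' : {l : nat & 'I_l -> set H}) :
  translation_equiv W W' -> translation_equiv W' W.
Proof.
move=> [s ->]; exists (- s); case: W => l W /=; congr existT.
by apply/funext => i; rewrite /translate_window translateD subrr translate0.
Qed.

Lemma translation_equiv_trans (W1 W2 W3 : {l : nat & 'I_l -> set H}) :
  translation_equiv W1 W2 -> translation_equiv W2 W3 -> translation_equiv W1 W3.
Proof.
move=> [s ->] [t ->]; exists (s + t); case: W1 => l W /=; congr existT.
by apply/funext => i; rewrite /translate_window translateD.
Qed.

Lemma row_int_sum_delta (z : 'rV[int]_k) : z = \sum_i delta_mx ord0 i *~ z ord0 i.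
Proof.
apply/rowP => j; rewrite summxE (bigD1 j)//= big1 => [|i ij].
  by rewrite -scaler_int !mxE !eqxx addr0 mulr1 intz.
by rewrite -scaler_int !mxE eqxx eq_sym (negbTE ij) mulr0.
Qed.

(** The difference vanishes on the projected lattice, which is relatively dense; it is therefore
    bounded, and a bounded linear map is zero. *)
Lemma linear_eq_on_lattice (L L' : {linear V -> V}) :
  (forall i, L (p (delta_mx ord0 i)) = L' (p (delta_mx ord0 i))) -> L = L' :> (V -> V).
Proof.
move=> LL'.
have LL'p z : L (p z) = L' (p z).
  rewrite (row_int_sum_delta z) !raddf_sum; apply: eq_bigr => i _.
  by rewrite !raddfMz; congr (_ *~ _); exact: LL'.
have [A A0 AP] := @linear_bounded R _ V (L : subvs_of (physical S) -> V) (linearP L).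
have [A' A'0 A'P] := @linear_bounded R _ V (L' : subvs_of (physical S) -> V) (linearP L').
have [K KP] := ps_cocompact pqS.
apply/funext => v; apply/eqP; rewrite -subr_eq0; apply/eqP.
apply: (@linear_bounded_eq0 _ V V (fun v => L v - L' v) (A * K + A' * K)) => [a x y|{}v].
  by rewrite !linearP/= scalerBr scalerN addrACA.
have [z [pz _]] := KP v 0.
have -> : L v - L' v = L' (p z - v) - L (p z - v).
  by rewrite (linearB L) (linearB L') LL'p opprB [RHS]addrC addrA subrK.
apply: le_trans (ler_normB _ _) _; rewrite [leRHS]addrC; apply: lerD.
  by apply: le_trans (A'P _) _; rewrite ler_wpM2l// ltW.
by apply: le_trans (AP _) _; rewrite ler_wpM2l// ltW.
Qed.

(** All real data, including the translation [s] and the constants, are quantified away. [Ms] lists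
    lifts of the images of the lattice basis, which determine [L]. *)
Definition window_code (W : {l : nat & 'I_l -> set H})
    (c : nat * seq 'rV[int]_k * (nat * nat * nat) *
         ('rV[int]_k * seq (nat * 'rV[int]_k) * seq (nat * 'rV[int]_k))) : Prop :=
  let: (l, Ms, (r, s0, rho), (ys, sP, sP')) := c in
  projT1 W = l /\
  exists s (L : 'End(V)) Li Lam C theta,
  [/\ regular_window (translate_window s (projT2 W)),
      expansion (L : V -> V) Li Lam C theta,
      forall i : 'I_k, L (p (delta_mx ord0 i)) = p (nth 0 Ms i),
      core_radius C theta r%:R 1 0 <= s0%:R &
      substitution_code p q L (translate_window s (projT2 W)) r s0 rho ys sP sP'].

Lemma window_code_exists W : sub_windows S W -> exists c, window_code W c.
Proof.
case: W => l W [/= wW sW].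
have [s [L [Li [Lam [C [theta [c [P' [rW nsW LE [c0 dP'] dp]]]]]]]]] :=
  sub_window_data bB bL wW sW.
have [M [MP _ _]] := lattice_lift pqS LE rW nsW c0 dp.
have [r [s0 [rho [ys [sP [sP' [rs0 code]]]]]]] :=
  substitution_code_exists pqS LE rW c0 dP' dp.
exists (l, [seq M (delta_mx ord0 i) | i : 'I_k], (r, s0, rho), (ys, sP, sP')).
split=> //; exists s, L, Li, Lam, C, theta; split=> // i.
by rewrite (nth_map i) ?size_enum_ord// nth_ord_enum MP.
Qed.

Lemma window_code_inj W W' c : window_code W c -> window_code W' c ->
  translation_equiv W W'.
Proof.
case: c => [[[l Ms] [[r s0] rho]] [[ys sP] sP']].
case: W => l1 W; case: W' => l2 W' /= [l1l]; subst l1.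
move=> [s [L [Li [Lam [C [theta [rW LE LM core code]]]]]]].
move=> [l12 ]; subst l2 => /= -[s' [L' [Li' [Lam' [C' [theta' [rW' _ LM' _ code']]]]]]].
have LL' : L = L' :> (V -> V).
  by apply: linear_eq_on_lattice => i; apply: etrans (LM i) _; exact/esym/LM'.
rewrite -LL' in code'.
have [w wP] := same_code_translate pqS LE rW rW' core code code'.
exists (s + w - s') => /=; congr existT; apply/funext => i.
have := congr1 (@translate H (- s')) (wP i).
by rewrite /translate_window !translateD subrr translate0 addrA.
Qed.

Theorem countable_sub_windows : countable_up_to (@translation_equiv R S) (sub_windows S).
Proof.
apply: (@countable_up_toP _ _ _ _ window_code).
- exact: translation_equiv_refl.
- exact: translation_equiv_sym.
- exact: translation_equiv_trans.
- exact: window_code_exists.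
by move=> W W' c _ _; exact: window_code_inj.
Qed.

End CountableWindows.

(** * Recovering the scheme from its integer matrix *)

Section BasisExtension.
Variables (R : realType) (E : vectType R) (k : nat) (b : k.-tuple E).
Hypothesis bB : basis_of {:E} b.

Lemma basis_extension (E' : vectType R) (c : 'I_k -> E') :
  exists f : 'Hom(E, E'), forall i : 'I_k, f b`_i = c i.
Proof.
pose g x := \sum_(i < k) coord b i x *: c i.
have gl : linear g.
  move=> a x y; rewrite /g scaler_sumr -big_split; apply: eq_bigr => i _ /=.
  by rewrite linearP/= scalerDl scalerA.
pose g' : {linear E -> E'} := HB.pack g (GRing.isLinear.Build _ _ _ _ g gl).
exists (linfun g') => i; rewrite lfunE /= /g (bigD1 i)//= big1 => [|j ji].
  by rewrite (coord_free _ _ (basis_free bB)) eqxx scale1r addr0.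
by rewrite (coord_free _ _ (basis_free bB)) eq_sym (negbTE ji) scale0r.
Qed.

Lemma linear_on_basis (X : lmodType R) (f : E -> X) : linear f ->
  forall x, f x = \sum_(i < k) coord b i x *: f b`_i.
Proof.
move=> lf x; pose f' : {linear E -> X} := HB.pack f (GRing.isLinear.Build _ _ _ _ f lf).
rewrite {1}(coord_basis bB (memvf x)) -[f _]/(f' _) linear_sum.
by apply: eq_bigr => i _; rewrite linearZ.
Qed.

Lemma linear_eq_basis (X : lmodType R) (f g : E -> X) : linear f -> linear g ->
  (forall i : 'I_k, f b`_i = g b`_i) -> f =1 g.
Proof.
move=> lf lg fg x; rewrite (linear_on_basis lf) (linear_on_basis lg).
by apply: eq_bigr => i _; rewrite fg.
Qed.

Lemma lattice_point_delta i : lattice_point b (delta_mx ord0 i) = b`_i.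
Proof.
rewrite /lattice_point (bigD1 i)//= big1 => [|j ji].
  by rewrite mxE !eqxx addr0.
by rewrite mxE eqxx (negbTE ji).
Qed.

End BasisExtension.

Lemma iter_linear (R : realType) (X : lmodType R) (f : X -> X) n :
  linear f -> linear (iter n f).
Proof. by move=> lf a x y; elim: n => //= n ->; rewrite lf. Qed.

(** [M] is the real-linear extension of the integer matrix [Ms]. The contraction is measured in
    lattice coordinates, which two schemes with the same matrix share. *)
Record lifted_expansion (R : realType) (S : scheme R) k (b : k.-tuple (Defs.total S))
    (Ms : seq 'rV[int]_k) (M : 'End(Defs.total S))
    (L Li : physical_space S -> physical_space S) (Lam C theta : R) : Prop :=
  LiftedExpansion {
  le_basis : basis_of {:Defs.total S} b;
  le_lattice : lattice S = range (lattice_point b);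
  le_matrix : forall i : 'I_k, M b`_i = lattice_point b (nth 0 Ms i);
  le_expansion : expansion L Li Lam C theta;
  le_physical : forall x, physical_proj (M x) = L (physical_proj x);
  le_invariant : forall v : physical_space S, internal_proj (M (vsval v)) = 0;
  le_contraction : forall del, 0 < del -> exists N, forall n, (N <= n)%N ->
    forall x, `|internal_proj (iter n M x)| <= del * \sum_(i < k) `|coord b i x| }.

Section Existence.
Variables (R : realType) (S : scheme R).
Local Notation E := (Defs.total S).
Local Notation V := (physical_space S).
Local Notation H := (internal_space S).

Lemma lattice_basis : exists b : (\dim {:E}).-tuple E,
  basis_of {:E} b /\ lattice S = range (lattice_point b).
Proof.
have [b bB bL] := lattice_full_rank S; exists b; split=> //; rewrite bL.
apply/seteqP; split=> _ [z _ <-].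
  exists (\row_i z i) => //; rewrite /lattice_point.
  by apply: eq_bigr => i _; rewrite mxE.
by exists (fun i => z ord0 i).
Qed.

Lemma vsval_bounded (U : {vspace E}) (X : normedModType R) (f : E -> X) :
  linear f -> exists2 A, 0 < A &
    forall v : normed (subvs_of U), `|f (vsval v)| <= A * `|v|.
Proof.
move=> lf; apply: (@linear_bounded R _ X (fun v : subvs_of U => f (vsval v))).
by move=> a x y; rewrite linearP lf.
Qed.

Lemma lifted_expansion_exists : sub_windows S !=set0 ->
  exists k (b : k.-tuple E) Ms M L Li Lam C theta,
    lifted_expansion b Ms M L Li Lam C theta.
Proof.
move=> [[l W] [/= wW sW]]; have [b [bB bL]] := lattice_basis.
have [s [L [Li [Lam [C [theta [c [P' [rW nsW LE [c0 dP'] dp]]]]]]]]] :=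
  sub_window_data bB bL wW sW.
have pqS := scheme_projection bB bL.
have [M0 [M0P [eps eps0 M0eps] M0dec]] := lattice_lift pqS LE rW nsW c0 dp.
have [M MP] := basis_extension bB (fun i => lattice_point b (M0 (delta_mx ord0 i))).
have Mlat z : M (lattice_point b z) = lattice_point b (M0 z).
  transitivity (\sum_i lattice_point b (M0 (delta_mx ord0 i)) *~ z ord0 i).
    rewrite /lattice_point linear_sum; apply: eq_bigr => i _.
    by rewrite raddfMz; congr (_ *~ _); exact: MP.
  rewrite [in RHS](row_int_sum_delta z) !raddf_sum; apply: eq_bigr => i _.
  by rewrite !raddfMz.
have Mnlat n z : iter n M (lattice_point b z) = lattice_point b (iter n M0 z).
  by elim: n => //= n ->; rewrite Mlat.
have lM : linear M by exact: linearP.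
have lqM n : linear (fun x => internal_proj (iter n M x)).
  by move=> a x y; rewrite (iter_linear n lM) linearP.
exists (\dim {:E}), b, [seq M0 (delta_mx ord0 i) | i : 'I_(\dim {:E})], M,
  (L : V -> V), Li, Lam, C, theta; split=> //.
- by move=> i; rewrite (nth_map i) ?size_enum_ord// nth_ord_enum MP.
- apply: (linear_eq_basis bB).
  + by move=> a x y; rewrite !linearP.
  + by move=> a x y; rewrite !linearP.
  by move=> i; rewrite -lattice_point_delta Mlat; exact/esym/M0P.
- have qMB x y : internal_proj (M (x - y)) = internal_proj (M x) - internal_proj (M y).
    by rewrite !linearB.
  have qMD x y : internal_proj (M (x + y)) = internal_proj (M x) + internal_proj (M y).
    by rewrite !linearD.
  have qMlat z : internal_proj (M (lattice_point b z)) = int_pt b (M0 z) by rewrite Mlat.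
  have [A1 A10 A1P] := vsval_bounded (physical S) (lqM 1%N).
  have [A2 A20 A2P] := vsval_bounded (internal S) (lqM 1%N).
  have [rho rho0 rhoP] := uniform_density pqS eps0.
  (* Each physical vector is within bounded distance of a lattice vector with small internal part,
     whose image under [M] has internal part below 1. The map is thus bounded, hence zero. *)
  apply: (@linear_bounded_eq0 _ V H (fun v => internal_proj (M (vsval v)))
    (1 + (A1 * rho + A2 * eps))) => [a x y|v].
    by rewrite !linearP.
  have [z [pz]] := rhoP v 0; rewrite subr0 => qz.
  have -> : vsval v = lattice_point b z - (vsval (phys_pt b z - v) + vsval (int_pt b z)).
    by rewrite linearB/= addrAC proj_decomp subKr.
  rewrite qMB qMD qMlat.
  apply: le_trans (ler_normB _ _) _; apply: lerD; first exact/ltW/M0eps.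
  apply: le_trans (ler_normD _ _) _; apply: lerD.
    by apply: le_trans (A1P _) _; rewrite ler_wpM2l// ltW.
  by apply: le_trans (A2P _) _; rewrite ler_wpM2l// ltW.
move=> del del0.
have /choice[N NP] : forall i : 'I_(\dim {:E}), exists N, forall n, (N <= n)%N ->
    `|internal_proj (iter n M b`_i)| < del.
  move=> i; have [N NP] := M0dec (delta_mx ord0 i) del del0; exists N => n Nn.
  by rewrite -lattice_point_delta Mnlat; exact: NP.
exists (\max_i N i)%N => n Nn x.
rewrite (linear_on_basis bB (lqM n) x) mulr_sumr.
apply: le_trans (ler_norm_sum _ _ _) _; apply: ler_sum => i _.
rewrite normrZ mulrC ler_wpM2r//; apply/ltW/NP.
by apply: leq_trans Nn; exact: leq_bigmax.
Qed.

End Existence.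

Lemma norm_small_eq0 (R : realType) (X : normedModType R) (x : X) (B : R) :
  (forall del, 0 < del -> `|x| <= del * B) -> x = 0.
Proof.
move=> xB; apply/eqP; rewrite -normr_le0; apply/ler_addgt0Pl => e e0.
rewrite addr0; have B1 : 0 < `|B| + 1 by rewrite ltr_wpDl.
apply: le_trans (xB (e / (`|B| + 1)) _) _; first by rewrite divr_gt0.
rewrite -mulrA ler_piMr// ?(ltW e0)// mulrC ler_pdivrMr// mul1r.
by apply: le_trans (ler_norm _) _; rewrite lerDl.
Qed.

Section Intertwiner.
Variables (R : realType) (S S' : scheme R) (k : nat) (Ms : seq 'rV[int]_k).
Local Notation E := (Defs.total S).
Local Notation E' := (Defs.total S').
Variables (b : k.-tuple E) (M : 'End(E)) (L Li : physical_space S -> physical_space S).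
Variables (Lam C theta : R).
Hypothesis Sle : lifted_expansion b Ms M L Li Lam C theta.
Variables (b' : k.-tuple E') (M' : 'End(E')) (L' Li' : physical_space S' -> physical_space S').
Variables (Lam' C' theta' : R).
Hypothesis Sle' : lifted_expansion b' Ms M' L' Li' Lam' C' theta'.
Variable f : 'Hom(E, E').
Hypothesis fb : forall i : 'I_k, f b`_i = b'`_i.

Let bB := le_basis Sle.
Let bB' := le_basis Sle'.
Let LE := le_expansion Sle.
Let LE' := le_expansion Sle'.

Lemma intertwiner_lattice_point z : f (lattice_point b z) = lattice_point b' z.
Proof.
rewrite /lattice_point linear_sum; apply: eq_bigr => i _ /=.
by rewrite raddfMz; congr (_ *~ _); exact: fb.
Qed.

Lemma intertwiner_lattice : f @` lattice S = lattice S'.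
Proof.
rewrite (le_lattice Sle) (le_lattice Sle'); apply/seteqP; split=> x.
  by move=> [_ [z _ <-] <-]; exists z; rewrite // intertwiner_lattice_point.
by move=> [z _ <-]; exists (lattice_point b z); [exists z|rewrite intertwiner_lattice_point].
Qed.

Lemma intertwiner_iter n x : f (iter n M x) = iter n M' (f x).
Proof.
suff fM y : f (M y) = M' (f y) by elim: n => //= n IH; rewrite fM IH.
move: y; apply: (linear_eq_basis bB) => [a u v|a u v|i]; rewrite ?linearP//.
by rewrite fb (le_matrix Sle) (le_matrix Sle') intertwiner_lattice_point.
Qed.

Lemma intertwiner_coord i x : coord b' i (f x) = coord b i x.
Proof.
pose c (x : E) : R^o := coord b' i (f x); pose c' (x : E) : R^o := coord b i x.
rewrite -[LHS]/(c x) -[RHS]/(c' x); move: x.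
apply: (linear_eq_basis bB) => [a u v|a u v|j]; rewrite /c /c' ?linearP//.
by rewrite fb (coord_free _ _ (basis_free bB)) (coord_free _ _ (basis_free bB')).
Qed.

(* A physical vector is [M^n] of an exponentially small one, while the internal
   component of [M'^n] stays bounded. *)
Lemma intertwiner_physical (v : physical_space S) : internal_proj (f (vsval v)) = 0.
Proof.
have /choice[A AP] : forall i : 'I_k, exists A, 0 < A /\
    forall v : physical_space S, `|coord b i (vsval v)| <= A * `|v|.
  move=> i; have [|A A00 AP] := @vsval_bounded R S (physical S) R^o (coord b i).
    by move=> a x y; rewrite linearP.
  by exists A.
apply: (@norm_small_eq0 _ _ _ (\sum_i A i * (C * `|v|))) => del del0.
have [N NP] := le_contraction Sle' del0.
have Mn n w : iter n M (vsval w) = vsval (iter n L w).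
  elim: n w => //= n IH w; rewrite IH.
  by rewrite -[LHS]proj_decomp (le_physical Sle) (le_invariant Sle) physical_projK linear0 addr0.
have -> : vsval v = iter N M (vsval (iter N Li v)) by rewrite Mn (iter_LLi LE).
rewrite intertwiner_iter; apply: le_trans (NP _ (leqnn N) _) _.
rewrite ler_wpM2l//; first exact: ltW.
apply: ler_sum => i _; rewrite intertwiner_coord; apply: le_trans ((AP i).2 _) _.
rewrite ler_wpM2l//; first exact/ltW/(AP i).1.
apply: le_trans (ex_decay LE _ _) _; rewrite ler_wpM2r// ler_piMr ?exprn_ile1//.
- exact/ltW/(ex_C0 LE).
- exact/ltW/(ex_theta0 LE).
- exact/ltW/(ex_theta1 LE).
Qed.

(** [M^N h] is internal and tends to [0], so the physical part of [f (M^N h)] tends to [0]. It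
    equals [L'^N] of the physical part of [f h], and the powers of [L'^-1] are bounded by [C']. *)
Lemma intertwiner_internal (h : internal_space S) : physical_proj (f (vsval h)) = 0.
Proof.
have [|A A00 AP] := @vsval_bounded R S (internal S) (physical_space S')
    (fun x => physical_proj (f x)).
  by move=> a x y; rewrite !linearP.
apply: (@norm_small_eq0 _ _ _ (C' * A * (\sum_(i < k) `|coord b i (vsval h)|))) => del del0.
have [N NP] := le_contraction Sle del0.
have Mp n x : physical_proj (iter n M x) = iter n L (physical_proj x).
  by elim: n => //= n IH; rewrite (le_physical Sle) IH.
have Mp' n x : physical_proj (iter n M' x) = iter n L' (physical_proj x).
  by elim: n => //= n IH; rewrite (le_physical Sle') IH.
have Mnh : iter N M (vsval h) = vsval (internal_proj (iter N M (vsval h))).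
  rewrite -[LHS]proj_decomp Mp physical_proj_internal.
  have -> : iter N L 0 = 0.
    by have := iter_LD LE N 0 0; rewrite addr0 -[LHS]addr0 => /addrI <-.
  by rewrite linear0 add0r.
rewrite -[physical_proj _](iter_LiL LE' N) -Mp' -intertwiner_iter Mnh.
apply: le_trans (ex_decay LE' _ _) _.
have C'0 := ex_C0 LE'; have th0 := ex_theta0 LE'; have th1 := ex_theta1 LE'.
apply: (@le_trans _ _ (C' * (A * (del * \sum_(i < k) `|coord b i (vsval h)|)))).
  apply: ler_pM => //; first by rewrite mulr_ge0 ?exprn_ge0// ltW.
    by rewrite ler_piMr ?exprn_ile1// ltW.
  apply: le_trans (AP _) _; rewrite ler_wpM2l//; first exact: ltW.
  exact: NP.
by rewrite le_eqVlt; apply/orP; left; apply/eqP; ring.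
Qed.

End Intertwiner.

Section SchemeIso.
Variable R : realType.

Lemma scheme_iso_intro (S S' : scheme R) (f : 'Hom(Defs.total S, Defs.total S'))
    (g : 'Hom(Defs.total S', Defs.total S)) :
  cancel f g -> cancel g f ->
  (forall v : physical_space S, internal_proj (f (vsval v)) = 0) ->
  (forall v : physical_space S', internal_proj (g (vsval v)) = 0) ->
  (forall h : internal_space S, physical_proj (f (vsval h)) = 0) ->
  (forall h : internal_space S', physical_proj (g (vsval h)) = 0) ->
  f @` lattice S = lattice S' -> scheme_iso S S'.
Proof.
move=> fg gf fV gV fH gH fL; exists f; split=> //; first by exists g.
  apply/vspaceP => y; apply/memv_imgP/idP => [[x xV ->]|yV].
    by apply/internal_proj_eq0; rewrite -(vsprojK xV) fV.
  exists (g y); last by rewrite gf.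
  by apply/internal_proj_eq0; rewrite -(vsprojK yV) gV.
apply/vspaceP => y; apply/memv_imgP/idP => [[x xH ->]|yH].
  by apply/physical_proj_eq0; rewrite -(vsprojK xH) fH.
exists (g y); last by rewrite gf.
by apply/physical_proj_eq0; rewrite -(vsprojK yH) gH.
Qed.

Lemma scheme_iso_refl (S : scheme R) : scheme_iso S S.
Proof.
exists \1%VF; split.
- by exists id => x; rewrite lfunE.
- exact: lim1g.
- exact: lim1g.
by apply/seteqP; split=> [x [y Sy <-]|x Sx]; [rewrite lfunE|exists x; rewrite ?lfunE].
Qed.

Lemma scheme_iso_sym (S S' : scheme R) : scheme_iso S S' -> scheme_iso S' S.
Proof.
move=> [f [fbij fV fH fL]].
have kf : lker f == 0%VS by apply/lker0P; exact: bij_inj.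
have fK := lker0_lfunK kf.
have fVK : cancel (f^-1)%VF f by move=> y; have [g fg gf] := fbij; rewrite -[y]gf fK.
exists (f^-1)%VF; split.
- by exists f.
- by rewrite -fV -limg_comp lker0_compVf// lim1g.
- by rewrite -fH -limg_comp lker0_compVf// lim1g.
rewrite -fL; apply/seteqP; split=> [x [_ [y Sy <-] <-]|x Sx]; first by rewrite fK.
by exists (f x); [exists x|rewrite fK].
Qed.

Lemma scheme_iso_trans (S1 S2 S3 : scheme R) :
  scheme_iso S1 S2 -> scheme_iso S2 S3 -> scheme_iso S1 S3.
Proof.
move=> [f [fbij fV fH fL]] [g [gbij gV gH gL]]; exists (g \o f)%VF; split.
- by have /eq_bij := bij_comp gbij fbij; apply=> x; rewrite comp_lfunE.
- by rewrite limg_comp fV gV.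
- by rewrite limg_comp fH gH.
rewrite -gL -fL; apply/seteqP; split=> [_ [x Sx <-]|_ [_ [x Sx <-] <-]].
  by rewrite lfunE; exists (f x) => //; exists x.
by exists x; rewrite // lfunE.
Qed.

Definition scheme_code (S : scheme R) (c : {k : nat & seq 'rV[int]_k}) : Prop :=
  exists b M L Li Lam C theta,
    @lifted_expansion R S (tag c) b (tagged c) M L Li Lam C theta.

(** The map matching the two lattice bases commutes with the common matrix; the intertwiner lemmas,
    applied to it and to its inverse, show that it respects both splittings. *)
Lemma scheme_code_inj (S S' : scheme R) c :
  scheme_code S c -> scheme_code S' c -> scheme_iso S S'.
Proof.
case: c => k Ms [b [M [L [Li [Lam [C [theta /= Sle]]]]]]].
move=> [b' [M' [L' [Li' [Lam' [C' [theta' /= Sle']]]]]]].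
have bB := le_basis Sle; have bB' := le_basis Sle'.
have [f fb] := basis_extension bB (fun i => b'`_i).
have [g gb] := basis_extension bB' (fun i => b`_i).
apply: (@scheme_iso_intro _ _ f g).
- apply: (linear_eq_basis bB) => [a u v|//|i]; first by rewrite !linearP.
  by rewrite fb gb.
- apply: (linear_eq_basis bB') => [a u v|//|i]; first by rewrite !linearP.
  by rewrite gb fb.
- exact: (intertwiner_physical Sle Sle' fb).
- exact: (intertwiner_physical Sle' Sle gb).
- exact: (intertwiner_internal Sle Sle' fb).
- exact: (intertwiner_internal Sle' Sle gb).
exact: (intertwiner_lattice Sle Sle' fb).
Qed.

End SchemeIso.

Theorem theorem3p19 (R : realType) :
  countable_up_to (@scheme_iso R) (fun S => sub_windows S !=set0) /\
  (forall S : scheme R, sub_windows S !=set0 ->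
     countable_up_to (@translation_equiv R S) (sub_windows S)).
Proof.
split.
  apply: (@countable_up_toP _ _ _ {k : nat & seq 'rV[int]_k} (@scheme_code R)).
  - exact: scheme_iso_refl.
  - exact: scheme_iso_sym.
  - exact: scheme_iso_trans.
  - move=> S /lifted_expansion_exists[k [b [Ms [M [L [Li [Lam [C [theta Sle]]]]]]]]].
    by exists (existT _ k Ms), b, M, L, Li, Lam, C, theta.
  by move=> S S' c _ _; exact: scheme_code_inj.
move=> S _; have [b [bB bL]] := lattice_basis S.
exact: countable_sub_windows bB bL.
Qed.
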